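(* Let $p,q,s>0$ and $r\ge0$ with $p+q+r+s=1$, and put $P_r=\frac{p}{1-r}$, $Q_r=\frac{q}{1-r}$, $S_r=\frac{s}{1-r}$, so $P_r+Q_r+S_r=1$. Let $D$ be one of $[0,N]$ ($N\ge1$ an integer), $[0,\infty)$, $(-\infty,\infty)$. Then the $[pqrs]$ walk and the conjugate $[P_rQ_rS_r]$ walk on $D$, started in the same state $i\in D$, give the same results for the following: (1) the distribution of the minimum and the distribution of the maximum of the walk; (2) the probability of absorption in state $n$, for every $n\in D$; (3) the asymptotic behavior of the absorption probabilities: the asymptotic expressions (for $s\to0$, on $(-\infty,\infty)$ with starting state $0$) for the probability of absorption in $n$, in $\{n\le-1\}$, and in $\{n\ge1\}$, namely for $p>q$ $$\frac{s}{p-q}\left\{1-\left[\frac{n}{p-q}+\frac{p+q}{(p-q)^2}\right]s\right\}\ (n\ge0),\qquad \frac{(p/q)^ns}{p-q}\left\{1-\left[\frac{-n}{p-q}+\frac{p+q}{(p-q)^2}\right]s\right\}\ (n\le0),$$ $$\frac{qs}{(p-q)^2}\left\{1-\frac{2p+q}{(p-q)^2}s\right\}\ (\text{absorption in }\{n\le-1\}),\qquad 1-\frac{ps}{(p-q)^2}\ (\text{absorption in }\{n\ge1\}),$$ and for $p=q$ $$\frac12-\frac14\sqrt{\frac sp}\ (\text{absorption in }\{n\ge1\},\text{ and likewise in }\{n\le-1\}),\qquad \frac12\sqrt{\frac sp}\ (\text{absorption in }0),$$ are unchanged when $(p,q,s)$ is replaced by $(P_r,Q_r,S_r)$; (4)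 the value of the game. Moreover, the expected time until absorption in the conjugate walk is $(1-r)$ times the expected time until absorption in the original walk.
   Context: A $[pqrs]$ random walk on an interval $D$ of integers: in each state $n$ that is not an absorbing barrier, at each time unit the walk moves to $n+1$ with probability $p$, moves to $n-1$ with probability $q$, stays in $n$ for a time unit with probability $r$, and with probability $s$ is absorbed in the current state $n$ (the process terminates there). The finite endpoints of $D$ are absorbing barriers: $0$ and $N$ for $[0,N]$, $0$ for $[0,\infty)$, none for $(-\infty,\infty)$; when the walk reaches a barrier it is absorbed there. The conjugate $[P_rQ_rS_r]$ walk is the walk of the same kind with forward probability $P_r$, backward probability $Q_r$, probability $0$ of staying, and probability $S_r$ of absorption in the current state. The minimum and maximum are taken over all states visited until absorption, including the starting and final states. Each action (step, stay, or absorption in the current non-barrier state) takes one time unit; the time until absorption is the number of time units until the process terminates, and is $0$ when starting in a barrier. The value of the game is the expected value of the final position (the state in which the walk is absorbed). *)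

(* Defs.v *)
From HB Require Import structures.
From mathcomp Require Import all_boot all_order all_algebra.
From mathcomp Require Import all_classical all_reals all_analysis measurable_realfun.

Set Implicit Arguments.
Unset Strict Implicit.
Unset Printing Implicit Defensive.

Import Order.TTheory GRing.Theory Num.Theory.
Import numFieldTopology.Exports numFieldNormedType.Exports.

Local Open Scope classical_set_scope.
Local Open Scope ring_scope.

Variant domain := Segment of nat | HalfLine | Line.

Definition valid_domain (D : domain) : bool :=
  if D is Segment N then (1 <= N)%N else true.

Definition in_domain (D : domain) (n : int) : bool :=
  match D with
  | Segment N => (0 <= n) && (n <= N%:Z)
  | HalfLine => 0 <= n
  | Line => true
  end.

Definition barrier (D : domain) (n : int) : bool :=
  match D with
  | Segment N => (n == 0) || (n == N%:Z)
  | HalfLine => n == 0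
  | Line => false
  end.

(* [(n, false)]: the walk is in [n] and still running;
   [(n, true)]: the walk has been absorbed in [n]. *)
Definition status : Type := (int * bool)%type.

(* Entering a barrier is being absorbed there, without any further time unit. *)
Definition enter (D : domain) (n : int) : status := (n, barrier D n).

Definition transition (R : realType) (p q r s : R) (D : domain)
    (x y : status) : R :=
  if x.2 then (y == x)%:R
  else p * (y == enter D (x.1 + 1))%:R + q * (y == enter D (x.1 - 1))%:R
       + r * (y == (x.1, false))%:R + s * (y == (x.1, true))%:R.

(* [X] is a [pqrs] walk on [D] started in [i]: the law of [X] is given through
   its finite-dimensional distributions. *)
Record is_walk (R : realType) (p q r s : R) (D : domain) (i : int)
    (d : measure_display) (T : measurableType d) (P : probability T R)
    (X : nat -> T -> status) : Prop := IsWalk {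
  walk_measurable : forall (t : nat) (x : status),
    measurable (X t @^-1` [set x]) ;
  walk_law : forall (k : nat) (x : nat -> status),
    P [set w | forall t, (t <= k)%N -> X t w = x t] =
    ((x 0%N == enter D i)%:R
     * \prod_(t < k) transition p q r s D (x t) (x t.+1))%:E }.

(* The definitions below concern one trajectory [x]; those that are meaningful
   only when absorption takes place are applied to walks with [s > 0], which
   are absorbed almost surely. *)

Definition absorbed_at (x : nat -> status) (t : nat) : Prop :=
  (x t).2 /\ forall u, (u < t)%N -> ~~ (x u).2.

Definition visited (x : nat -> status) : set int :=
  [set (x t).1 | t in [set t | forall u, (u < t)%N -> ~~ (x u).2]].

Definition walk_min (R : realType) (x : nat -> status) : \bar R :=
  ereal_inf [set (n%:~R)%:E | n in visited x].

Definition walk_max (R : realType) (x : nat -> status) : \bar R :=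
  ereal_sup [set (n%:~R)%:E | n in visited x].

(* Infinite when the walk is never absorbed. *)
Definition absorption_time (R : realType) (x : nat -> status) : \bar R :=
  ereal_inf [set (t%:R)%:E | t in absorbed_at x].

Definition final_position (x : nat -> status) : int :=
  (x (xget 0%N (absorbed_at x))).1.

Definition absorbed_in (T : Type) (X : nat -> T -> status) (A : set int) :
    set T :=
  [set w | exists2 t, absorbed_at (X^~ w) t & A (X t w).1].

Section expressions.
Variable R : realType.
Implicit Types p q s : R.

Definition drift_nonneg (n : int) p q s : R :=
  s / (p - q) * (1 - (n%:~R / (p - q) + (p + q) / (p - q) ^+ 2) * s).

Definition drift_nonpos (n : int) p q s : R :=
  (p / q) ^ n * s / (p - q)
  * (1 - ((- n)%:~R / (p - q) + (p + q) / (p - q) ^+ 2) * s).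

Definition drift_left p q s : R :=
  q * s / (p - q) ^+ 2 * (1 - (2 * p + q) / (p - q) ^+ 2 * s).

Definition drift_right p q s : R := 1 - p * s / (p - q) ^+ 2.

Definition sym_side p q s : R := 1 / 2 - 1 / 4 * Num.sqrt (s / p).

Definition sym_zero p q s : R := 1 / 2 * Num.sqrt (s / p).

End expressions.

(* [E p q s] is an asymptotic expression, as [s] tends to 0, for the
   probability that the walk on the whole line started in 0 is absorbed in
   [A]; the error is [o (order s)].
   As [p + q + r + s = 1], the parameters cannot all be held fixed when [s]
   varies: they are families over a filter, [p] and [q] having positive limits
   that satisfy the same relation [regime] as [p] and [q].  This covers [p] and
   [q] fixed, [r] fixed, and the conjugate walks of such families. *)
Definition asymptotic_expression (R : realType) (regime : R -> R -> Prop)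
    (order : R -> R) (A : set int) (E : R -> R -> R -> R) : Prop :=
  forall (I : Type) (F : set_system I) (FF : ProperFilter F)
    (p q r s : I -> R) (p0 q0 : R)
    (d : I -> measure_display) (T : forall a, measurableType (d a))
    (P : forall a, probability (T a) R) (X : forall a, nat -> T a -> status),
  (forall a, [/\ 0 < p a, 0 < q a, 0 <= r a, 0 < s a
               & p a + q a + r a + s a = 1]) ->
  (forall a, regime (p a) (q a)) ->
  0 < p0 -> 0 < q0 -> regime p0 q0 ->
  p a @[a --> F] --> p0 -> q a @[a --> F] --> q0 ->
  s a @[a --> F] --> (0 : R) ->
  (forall a, is_walk (p a) (q a) (r a) (s a) Line 0 (P a) (X a)) ->
  (fine (P a (absorbed_in (X a) A)) - E (p a) (q a) (s a)) / order (s a)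
    @[a --> F] --> (0 : R).

(* Main.v *)
Require Import Defs.
From HB Require Import structures.
From mathcomp Require Import all_boot all_order all_algebra.
From mathcomp Require Import all_classical all_reals all_analysis measurable_realfun.
From mathcomp Require Import zify ring lra.

(** Staying in place only delays the walk, so removing the stays and rescaling
the other probabilities should change nothing but the clock.  Instead of
constructing this time change, the proof compares expected numbers of visits.

Fix a set [A] of allowed states and let [G n] be the expected number of time
units that the walk spends in [n] while running, all states so far being in [A]
([green]).  Decomposing a visit according to the previous state gives, with the
source term [delta] of the starting state and for [n] in [A] that is not a
barrier,
<<
   (1 - r) G(n) = delta(n) + p G(n - 1) + q G(n + 1)
>>
([green_eq]).  Each visit to [n] leads to absorption there with probability [s],
so that [G] is bounded by [1 / s]; and the equation has one bounded solution
only, because [p + q < 1 - r] ([green_unique]).  As [(1 - r) G] solves the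
equation of the conjugate walk, it is the Green function of that walk
([green_conjugate]).

The probability of absorption in [n] with a trajectory inside [A] is [s G(n)], or,
if [n] is a barrier other than the starting state, [p G(n - 1) + q G(n + 1)].
The factor [1 - r] cancels, and
this probability is the same for both walks ([absorbed_inside_conjugate]).  Since
absorption is almost sure ([never_absorbed0]), summing over [n] gives the
probability of being confined to [A] ([confined_conjugate]), hence the laws of
the minimum and of the maximum with [A] a half line; and with all states allowed
it gives the law of the final state, hence the value of the game.  The expected
absorption time is the sum of [G] over all states, which is multiplied by
[1 - r] ([expected_absorption_time_conjugate]).

On the whole line the bounded solution is explicit: it decreases geometrically
on both sides of 0, with ratios given by the roots of the characteristic
polynomial ([green_line]), and the absorption probabilities of points and rays
are algebraic functions of [p], [q], [s] and the square root [discr].  With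
[k = (discr - (p - q)) / s], which tends to [(p + q) / (p - q)], the errors
divided by their order are algebraic expressions in convergent quantities, whose
limits cancel.  Without drift, [discr] factors as [sqrt s * sqrt (4 p + s)].  The
asymptotic expressions themselves are homogeneous of degree 0 in [(p, q, s)],
and therefore invariant under conjugation. *)

Set Implicit Arguments.
Unset Strict Implicit.
Unset Printing Implicit Defensive.

Import Order.TTheory GRing.Theory Num.Theory.
Import numFieldTopology.Exports numFieldNormedType.Exports.

Local Open Scope classical_set_scope.
Local Open Scope ring_scope.

(** * Countably valued maps and the Markov property *)

Section fibers.
Context d (T : measurableType d) (K : countType) (Y : T -> K).
Hypothesis mY : forall k, measurable (Y @^-1` [set k]).

Lemma measurable_preimage_countType (B : set K) : measurable (Y @^-1` B).
Proof.
have -> : Y @^-1` B = \bigcup_(k in B) (Y @^-1` [set k]).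
  apply/seteqP; split => [w Bw|w [k Bk /= Yk]]; first by exists (Y w).
  by rewrite /= Yk.
rewrite bigcup_mkcond; apply: countable_bigcupT_measurable => [|k].
  exact: countableP.
by case: ifP.
Qed.

Lemma measure_fibers (R : realType) (mu : {measure set T -> \bar R}) (E : set T) :
  measurable E ->
  mu E = (\sum_(0 <= j <oo) mu (E `&` [set w | pickle (Y w) = j]))%E.
Proof.
move=> mE.
have EE : E = \bigcup_j (E `&` [set w | pickle (Y w) = j]).
  by apply/seteqP; split => [w Ew|w [j _ []]] //; exists (pickle (Y w)).
have mj j : measurable (E `&` [set w | pickle (Y w) = j]).
  by apply: measurableI => //; exact: (measurable_preimage_countType [set k | pickle k = j]).
rewrite {1}EE measure_semi_bigcup//.
- by move=> j j' _ _ [w [[_ <-] [_ <-]]].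
- by rewrite -EE.
Qed.

(** The form used when all but finitely many fibres turn out to be null. *)
Lemma measure_fibers_seq (R : realType) (mu : {measure set T -> \bar R})
    (E : set T) (s : seq K) : measurable E -> uniq s ->
  mu E = (\sum_(k <- s) mu (E `&` Y @^-1` [set k])
          + mu (E `&` [set w | Y w \notin s]))%E.
Proof.
elim: s => [|k s IH] mE /=.
  by rewrite big_nil add0e => _; congr (mu _); apply/seteqP; split => [w Ew|w []].
move=> /andP[ks us]; rewrite big_cons (IH mE us).
have mN : measurable (E `&` [set w | Y w \notin s]).
  by apply: measurableI => //; exact: (measurable_preimage_countType [set k | k \notin s]).
have -> : E `&` Y @^-1` [set k] = E `&` [set w | Y w \notin s] `&` Y @^-1` [set k].
  apply/seteqP; split => [w [Ew /= Yk]|w [[]]//].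
  by split => //; split => //=; rewrite Yk.
have -> : E `&` [set w | Y w \notin k :: s] =
    (E `&` [set w | Y w \notin s]) `\` Y @^-1` [set k].
  apply/seteqP; split => [w [Ew /=]|w [[Ew /= Ys] Yk]].
    by rewrite inE negb_or => /andP[/eqP Yk Ys].
  by split => //=; rewrite inE negb_or Ys andbT; apply/eqP.
by rewrite (measureDI mu mN (mY k)) -addeA addeCA [(mu _ + mu _)%E]addeC.
Qed.

End fibers.

(** A measure is the sum of its restrictions to the fibres of a countably valued
map.  An identity between the probabilities of two events, possibly for two
different processes, can thus be checked fibre by fibre. *)
Lemma fiberwise_measure_scale (R : realType) (K : countType) (c : R)
    d (T : measurableType d) (mu : {measure set T -> \bar R}) (Y : T -> K) (E : set T)
    d' (T' : measurableType d') (mu' : {measure set T' -> \bar R}) (Y' : T' -> K) (E' : set T') :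
  (forall k, measurable (Y @^-1` [set k])) -> (forall k, measurable (Y' @^-1` [set k])) ->
  measurable E -> measurable E' ->
  (forall k, mu' (E' `&` Y' @^-1` [set k]) = c%:E * mu (E `&` Y @^-1` [set k]))%E ->
  (mu' E' = c%:E * mu E)%E.
Proof.
move=> mY mY' mE mE' H.
rewrite (measure_fibers mY' mu' mE') (measure_fibers mY mu mE) -nneseriesZl//.
apply: eq_eseriesr => j _.
case Ej : (pickle_inv j : option K) => [k|].
  have Dj (U : Type) (Z : U -> K) : [set w | pickle (Z w) = j] = Z @^-1` [set k].
    apply/seteqP; split => [w /= Zj|w /= ->].
      by apply/Some_inj; rewrite -Ej -Zj pickleK_inv.
    by have := @pickle_invK K j; rewrite Ej.
  by rewrite !Dj.
have Dj (U : Type) (Z : U -> K) : [set w | pickle (Z w) = j] = set0.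
  by apply/seteqP; split => [w /= Zj|//]; rewrite -Zj pickleK_inv in Ej.
by rewrite !Dj !setI0 !measure0 mule0.
Qed.

Section walk_markov.
Context (R : realType) (p q r s : R) (D : domain) (i : int).
Context d (T : measurableType d) (P : probability T R) (X : nat -> T -> status).
Hypothesis hX : is_walk p q r s D i P X.

Let history (t : nat) (w : T) : seq (int * bool) := [seq X u w | u <- iota 0 t.+1].

Let eq_history t w w' : history t w = history t w' <-> forall u, (u <= t)%N -> X u w = X u w'.
Proof.
split => [/eq_in_map H u ut|H].
  by apply: H; rewrite mem_iota.
by apply/eq_in_map => u; rewrite mem_iota => /H.
Qed.

Let measurable_history t z : measurable (history t @^-1` [set z]).
Proof.
have [[w0 <-]|N] := pselect (exists w0, history t w0 = z); last first.
  suff -> : history t @^-1` [set z] = set0 by exact: measurable0.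
  by apply/seteqP; split => [w /= wz|//]; case: N; exists w.
suff -> : history t @^-1` [set history t w0] =
    \bigcap_(u in [set u | (u <= t)%N]) (X u @^-1` [set X u w0]).
  by apply: bigcap_measurable => [|u _]; first (by exists 0%N); exact: walk_measurable hX u _.
by apply/seteqP; split => w /eq_history.
Qed.

(** The events that only depend on the trajectory up to time [t].  Stating this
through pairs of sample points makes the property immediate for every concrete
event, and measurability follows since there are countably many histories. *)
Definition decided_by (t : nat) (E : set T) : Prop :=
  forall w w', (forall u, (u <= t)%N -> X u w = X u w') -> E w -> E w'.

Lemma decided_measurable t E : decided_by t E -> measurable E.
Proof.
move=> dE; have -> : E = history t @^-1` (history t @` E).
  apply/seteqP; split => [w Ew|w [w' Ew' /eq_history H]]; first by exists w.
  exact: dE Ew'.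
exact: measurable_preimage_countType (@measurable_history t) _.
Qed.

Lemma measurable_walk_status u (B : set status) : measurable (X u @^-1` B).
Proof. exact: (@measurable_preimage_countType _ _ (int * bool)%type (X u) (walk_measurable hX u)). Qed.

(** The Markov property.  On a single history, both sides are finite-dimensional
probabilities, and the longer product has exactly one factor more; the general
case is a sum over histories. *)
Lemma walk_markov t E x y : decided_by t E ->
  P (E `&` X t @^-1` [set x] `&` X t.+1 @^-1` [set y]) =
  ((transition p q r s D x y)%:E * P (E `&` X t @^-1` [set x]))%E.
Proof.
move=> dE; have mE := decided_measurable dE.
have mx := measurable_walk_status.
apply: (fiberwise_measure_scale (Y := history t) (Y' := history t));
  [exact: measurable_history|exact: measurable_history| | |].
- by apply: measurableI.
- by apply: measurableI => //; exact: measurableI.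
move=> z.
have [[w0 [[Ew0 /= xw0] <-]]|N] :=
  pselect ((E `&` X t @^-1` [set x] `&` history t @^-1` [set z]) !=set0); last first.
  rewrite (_ : _ `&` _ `&` X t.+1 @^-1` _ `&` _ = set0).
    rewrite (_ : _ `&` _ `&` _ = set0) ?measure0 ?mule0//.
    by apply/seteqP; split => // w H; case: N; exists w.
  by apply/seteqP; split => // w [[[H1 H2] H3] H4]; case: N; exists w.
have -> : E `&` X t @^-1` [set x] `&` history t @^-1` [set history t w0] =
    [set w | forall u, (u <= t)%N -> X u w = X u w0].
  apply/seteqP; split => [w [_ /eq_history]//|w H]; split; last exact/eq_history.
  by split; [apply: dE Ew0 => u ut; rewrite H|rewrite /= H].
have -> : E `&` X t @^-1` [set x] `&` X t.+1 @^-1` [set y]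
    `&` history t @^-1` [set history t w0] =
    [set w | forall u, (u <= t.+1)%N -> X u w = if (u <= t)%N then X u w0 else y].
  apply/seteqP; split => [w [[_ Xy] /eq_history H] u|w H].
    by rewrite leq_eqVlt ltnS => /predU1P[->|ut]; [rewrite ltnn|rewrite ut H].
  have H' u : (u <= t)%N -> X u w = X u w0 by move=> ut; rewrite H ?ut// leqW.
  split; last exact/eq_history.
  split; last by rewrite /= H// ltnn.
  by split; [apply: dE Ew0 => u ut; rewrite H'|rewrite /= H'].
rewrite (walk_law hX t (X^~ w0)) (walk_law hX t.+1 (fun u => if (u <= t)%N then X u w0 else y)).
rewrite -EFinM; congr (_%:E).
rewrite big_ord_recr /= ltnn leqnn xw0 [RHS]mulrC mulrA; congr (_ * _ * _).
by apply: eq_bigr => u _; rewrite (ltnW (ltn_ord u)) ltn_ord.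
Qed.

End walk_markov.

(** * One step of the walk *)

Lemma nneseries_shift (R : realType) (f : nat -> \bar R) : (forall t, 0 <= f t)%E ->
  (\sum_(0 <= t <oo) f t = f 0%N + \sum_(0 <= t <oo) f t.+1)%E.
Proof.
move=> f0; rewrite nneseries_recl// -(nneseries_addn 1)//.
by congr (_ + _)%E; apply: eq_eseriesr => t _; rewrite addn1.
Qed.

(** Iterating the inequality [k] times bounds [`|h n|] by [(a + b) ^+ k * K]: this
is the uniqueness of the bounded solution of the equation for visits. *)
Lemma bounded_subaverage_eq0 (R : realType) (a b K : R) (h : int -> R) :
  0 <= a -> 0 <= b -> a + b < 1 -> (forall n, `|h n| <= K) ->
  (forall n, `|h n| <= a * `|h (n - 1)| + b * `|h (n + 1)|) -> forall n, h n = 0.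
Proof.
move=> a0 b0 ab1 hK hab n; apply/eqP; rewrite -normr_le0.
have K0 : 0 <= K by exact: le_trans (normr_ge0 _) (hK 0).
have bd k m : `|h m| <= (a + b) ^+ k * K.
  elim: k m => [|k IH] m; first by rewrite expr0 mul1r.
  apply: le_trans (hab m) _; rewrite exprS -mulrA mulrDl.
  by apply: lerD; apply: ler_wpM2l.
have cv : (a + b) ^+ k * K @[k --> \oo] --> 0 * K.
  apply: cvgM; last exact: cvg_cst.
  by apply: cvg_expr; rewrite ger0_norm// addr_ge0.
rewrite -(mul0r K); apply: (cvgr_to_ge cv).
by apply: nearW => k; exact: bd.
Qed.

Definition walk_parameters (R : realType) (p q r s : R) : Prop :=
  [/\ 0 <= p, 0 <= q, 0 <= r, 0 < s & p + q + r + s = 1].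

Section walk_visits.
Context (R : realType) (p q r s : R) (D : domain) (i : int).
Context d (T : measurableType d) (P : probability T R) (X : nat -> T -> status).
Hypothesis hX : is_walk p q r s D i P X.
Implicit Types (A : set int) (n : int) (t : nat).

(** All notions below are relative to a set [A] of allowed states.  With [A] the set of
all states they describe the walk itself; with [A] a half line they describe
its minimum and its maximum. *)
Definition running A t : set T :=
  [set w | forall u, (u <= t)%N -> A (X u w).1 /\ ~~ (X u w).2].

Definition absorbing A t n : set T :=
  [set w | (forall u, (u < t)%N -> A (X u w).1 /\ ~~ (X u w).2) /\
           (A n /\ X t w = (n, true))].

(** The expected number of time units spent in [n] by the walk killed outside [A]:
its Green function. *)
Definition visits A n : \bar R :=
  (\sum_(0 <= t <oo) P (running A t `&` X t @^-1` [set (n, false)]))%E.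

Lemma decided_running A t : decided_by X t (running A t).
Proof. by move=> w w' ww' H u ut; rewrite -ww'//; exact: H. Qed.

Lemma measurable_running A t : measurable (running A t).
Proof. exact: (decided_measurable hX (@decided_running A t)). Qed.

Lemma measurable_absorbing A t n : measurable (absorbing A t n).
Proof.
apply: (@decided_measurable _ _ _ _ _ _ _ _ _ _ _ hX t) => w w' ww' [H [An E]].
by split; [move=> u ut; rewrite -ww' 1?ltnW//; exact: H|rewrite -ww'].
Qed.

Lemma transition_running m n (b : bool) :
  transition p q r s D (m, false) (n, b) =
  p * ((m == n - 1) && (b == barrier D n))%:R + q * ((m == n + 1) && (b == barrier D n))%:R
  + r * ((m == n) && ~~ b)%:R + s * ((m == n) && b)%:R.
Proof.
rewrite /transition /enter /= !xpair_eqE.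
have -> : (n == m + 1) = (m == n - 1) by apply/eqP/eqP; lia.
have -> : (n == m - 1) = (m == n + 1) by apply/eqP/eqP; lia.
rewrite [n == m]eq_sym eqbF_neg eqb_id; congr (_ * _%:R + _ * _%:R + _ + _).
  by case: eqP => // ->; rewrite subrK.
by case: eqP => // ->; rewrite addrK.
Qed.

Lemma transition_absorbed n : transition p q r s D (n, false) (n, true) = s.
Proof.
rewrite transition_running.
have -> : (n == n - 1) = false by apply/eqP; lia.
have -> : (n == n + 1) = false by apply/eqP; lia.
by rewrite eqxx /= !mulr0 !add0r mulr1.
Qed.

(** Decomposition according to the state at time [t]: only [n - 1], [n + 1] and [n]
have a positive probability of leading to [n], and a barrier is entered in the
absorbed status. *)
Lemma running_step A t n (b : bool) :
  P (running A t `&` X t.+1 @^-1` [set (n, b)]) =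
  ((p * (b == barrier D n)%:R)%:E * P (running A t `&` X t @^-1` [set ((n - 1)%R, false)])
   + (q * (b == barrier D n)%:R)%:E * P (running A t `&` X t @^-1` [set ((n + 1)%R, false)])
   + (if b then s else r)%:E * P (running A t `&` X t @^-1` [set (n, false)]))%E.
Proof.
have mE := @measurable_running A t; have mX := measurable_walk_status hX.
have mEb : measurable (running A t `&` X t.+1 @^-1` [set (n, b)]) by exact: measurableI.
pose z : seq (int * bool) := [:: (n - 1, false); (n + 1, false); (n, false)].
have uz : uniq z.
  rewrite /= !inE !xpair_eqE !andbT.
  by apply/andP; split; [apply/norP; split|]; apply/eqP; lia.
set E := running A t `&` X t.+1 @^-1` [set (n, b)].
(* [E] meets every other fibre in a null set, by the Markov property. *)
have rest : P (E `&` [set w | X t w \notin z]) = 0%E.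
  transitivity (0%:E * P setT)%E; last by rewrite mul0e.
  apply: (@fiberwise_measure_scale R (int * bool)%type 0 _ _ P (X t) _ _ _ P (X t)) => //.
    by apply: measurableI => //; exact: (mX t [set k | k \notin z]).
  rewrite /E => -[m c]; rewrite mul0e.
  have [mcz|mcz] := boolP ((m, c) \in z).
    rewrite (_ : _ `&` _ = set0) ?measure0//.
    by apply/seteqP; split => // w [[_ /= +] /= Xw]; rewrite Xw mcz.
  apply/eqP; rewrite -measure_le0; apply/idP.
  apply: (@le_trans _ _ (P (running A t `&` X t @^-1` [set (m, c)] `&` X t.+1 @^-1` [set (n, b)]))).
    apply: le_measure; rewrite ?inE.
    - by do 2?apply: measurableI => //; exact: (mX t [set k | k \notin z]).
    - by do 2?apply: measurableI.
    - by move=> w [[[? ?] _] ?].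
  rewrite (walk_markov hX _ _ (@decided_running A t)).
  case: c mcz => mcz.
    rewrite (_ : _ `&` _ = set0) ?measure0 ?mule0//.
    by apply/seteqP; split => // w [/(_ t (leqnn _))[_ /negP H] /= Xw]; rewrite Xw in H.
  rewrite transition_running.
  move: mcz; rewrite /z !inE !xpair_eqE !andbT !negb_or => /and3P[/negbTE-> /negbTE-> /negbTE->].
  by rewrite /= !mulr0 !addr0 mul0e.
have -> : P E = (P (E `&` X t @^-1` [set ((n - 1)%R, false)]) +
    P (E `&` X t @^-1` [set ((n + 1)%R, false)]) + P (E `&` X t @^-1` [set (n, false)]))%E.
  have := @measure_fibers_seq _ _ (int * bool)%type _ (fun k => mX t [set k]) _ P _ z mEb uz.
  by rewrite /z !big_cons big_nil adde0 addeA => ->; rewrite [X in (_ + X)%E]rest adde0.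
have mk m : P (running A t `&` X t.+1 @^-1` [set (n, b)] `&` X t @^-1` [set (m, false)]) =
   ((transition p q r s D (m, false) (n, b))%:E * P (running A t `&` X t @^-1` [set (m, false)]))%E.
  by rewrite setIAC (walk_markov hX _ _ (@decided_running A t)).
rewrite /E !mk !transition_running !eqxx.
have -> : (n - 1 == n + 1) = false by apply/eqP; lia.
have -> : (n + 1 == n - 1) = false by apply/eqP; lia.
have -> : (n - 1 == n) = false by apply/eqP; lia.
have -> : (n + 1 == n) = false by apply/eqP; lia.
have -> : (n == n + 1) = false by apply/eqP; lia.
have -> : (n == n - 1) = false by apply/eqP; lia.
rewrite /= !mulr0 !addr0 !add0r.
by case: b {E rest mk mEb} => /=; rewrite !(mulr0, mulr1, addr0, add0r).
Qed.

Lemma law0 x : P (X 0%N @^-1` [set x]) = ((x == enter D i)%:R)%:E.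
Proof.
have := walk_law hX 0 (fun=> x); rewrite big_ord0 mulr1 => <-.
congr (P _); apply/seteqP; split => [w /= H u|w /= H]; last exact: H.
by rewrite leqn0 => /eqP ->.
Qed.

Lemma visit0 A n : P (running A 0 `&` X 0%N @^-1` [set (n, false)]) =
  (((n == i) && ~~ barrier D n && (n \in A))%:R)%:E.
Proof.
have [nA|nA] := boolP (n \in A).
  rewrite andbT (_ : _ `&` _ = X 0%N @^-1` [set (n, false)]); last first.
    apply/seteqP; split => [w []//|w /= Xw]; split => // u.
    by rewrite leqn0 => /eqP ->; rewrite Xw /=; rewrite inE in nA.
  rewrite law0 /enter xpair_eqE; case: eqP => //= ->.
  by rewrite eq_sym eqbF_neg.
rewrite andbF (_ : _ `&` _ = set0) ?measure0//.
apply/seteqP; split => // w [/(_ 0%N (leqnn _))[+ _] Xw]; rewrite Xw /= => An.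
by move/negP: nA; apply; rewrite inE.
Qed.

Lemma visitS A t n : P (running A t.+1 `&` X t.+1 @^-1` [set (n, false)]) =
  (((n \in A)%:R)%:E * P (running A t `&` X t.+1 @^-1` [set (n, false)]))%E.
Proof.
have [nA|nA] := boolP (n \in A); rewrite ?mul1e ?mul0e.
  congr (P _); apply/seteqP; split => w [H Xw]; split => //.
    by move=> u ut; apply: H; rewrite leqW.
  move=> u; rewrite leq_eqVlt ltnS => /predU1P[->|]; last exact: H.
  by rewrite Xw /=; rewrite inE in nA.
rewrite (_ : _ `&` _ = set0) ?measure0//.
apply/seteqP; split => // w [/(_ t.+1 (leqnn _))[+ _] Xw]; rewrite Xw /= => An.
by move/negP: nA; apply; rewrite inE.
Qed.

Lemma absorbing0 A n : P (absorbing A 0 n) =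
  (((n == i) && barrier D n && (n \in A))%:R)%:E.
Proof.
have [nA|nA] := boolP (n \in A).
  rewrite andbT (_ : absorbing _ _ _ = X 0%N @^-1` [set (n, true)]); last first.
    by apply/seteqP; split => [w [_ []]//|w /= Xw]; split => //; split => //; rewrite inE in nA.
  rewrite law0 /enter xpair_eqE; case: eqP => //= ->.
  by case: barrier.
rewrite andbF (_ : absorbing _ _ _ = set0) ?measure0//.
by apply/seteqP; split => // w [_ [An _]]; move/negP: nA; apply; rewrite inE.
Qed.

Lemma absorbingS A t n : P (absorbing A t.+1 n) =
  (((n \in A)%:R)%:E * P (running A t `&` X t.+1 @^-1` [set (n, true)]))%E.
Proof.
have [nA|nA] := boolP (n \in A); rewrite ?mul1e ?mul0e.
  congr (P _); apply/seteqP; split => [w [H [_ Xw]]//|w [H Xw]]; split => //.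
  by split => //; rewrite inE in nA.
rewrite (_ : absorbing _ _ _ = set0) ?measure0//.
by apply/seteqP; split => // w [_ [An _]]; move/negP: nA; apply; rewrite inE.
Qed.

End walk_visits.

(** * The Green function and almost sure absorption *)

Section walk_green.
Context (R : realType) (p q r s : R) (D : domain) (i : int).
Hypothesis params : walk_parameters p q r s.
Let p0 : 0 <= p. Proof. by case: params. Qed.
Let q0 : 0 <= q. Proof. by case: params. Qed.
Let r0 : 0 <= r. Proof. by case: params. Qed.
Let s0 : 0 < s. Proof. by case: params. Qed.
Let pqrs : p + q + r + s = 1. Proof. by case: params. Qed.
Context d (T : measurableType d) (P : probability T R) (X : nat -> T -> status).
Hypothesis hX : is_walk p q r s D i P X.
Implicit Types (A : set int) (n : int) (t : nat).

Let mrun A t : measurable (running X A t) := measurable_running hX A t.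
Let mst t B : measurable (X t @^-1` B) := measurable_walk_status hX t B.

(** Each visit to [n] is followed by absorption in [n] with probability [s], and
absorptions at different times are disjoint events. *)
Lemma visits_le A n : (s%:E * visits P X A n <= 1)%E.
Proof.
rewrite /visits -nneseriesZl//.
pose F t := running X A t `&` X t @^-1` [set (n, false)] `&` X t.+1 @^-1` [set (n, true)].
have mF t : measurable (F t) by do 2?apply: measurableI.
rewrite (eq_eseriesr (g := fun t => P (F t))) => [|t _]; last first.
  rewrite /F (walk_markov hX _ _ (@decided_running _ _ X A t)).
  by rewrite transition_absorbed.
rewrite -measure_semi_bigcup//; last 2 first.
- have lt t t' w : (t < t')%N -> F t w -> F t' w -> False.
    move=> tt' [_ Xt] [[/(_ t.+1 tt')[_ +] _] _].
    by rewrite Xt.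
  move=> t t' _ _ [w [Fw Fw']]; apply/eqP.
  by have [tt'|tt'|//] := ltngtP t t'; [case: (lt _ _ _ tt' Fw Fw')|case: (lt _ _ _ tt' Fw' Fw)].
- exact: bigcupT_measurable.
exact/probability_le1/bigcupT_measurable.
Qed.

Lemma visits_ge0 A n : (0 <= visits P X A n)%E.
Proof. exact: nneseries_ge0. Qed.

Lemma visits_fin A n : visits P X A n \is a fin_num.
Proof.
rewrite ge0_fin_numE ?visits_ge0//.
have := visits_le A n; case: (visits P X A n) (visits_ge0 A n) => [x| |]//.
  by rewrite ltry.
by rewrite gt0_muley ?lte_fin.
Qed.

Definition green A n : R := fine (visits P X A n).

Lemma visitsE A n : visits P X A n = (green A n)%:E.
Proof. by rewrite /green fineK// visits_fin. Qed.

Lemma green_ge0 A n : 0 <= green A n.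
Proof. by rewrite -lee_fin -visitsE visits_ge0. Qed.

Lemma green_le A n : green A n <= s^-1.
Proof.
have := visits_le A n; rewrite visitsE -EFinM lee_fin.
by rewrite -ler_pdivlMl// mulr1.
Qed.

Lemma sum_running_step A n (b : bool) :
  (\sum_(0 <= t <oo) P (running X A t `&` X t.+1 @^-1` [set (n, b)]) =
  (p * (b == barrier D n)%:R * green A (n - 1) + q * (b == barrier D n)%:R * green A (n + 1)
   + (if b then s else r) * green A n)%:E)%E.
Proof.
under eq_eseriesr do rewrite (running_step hX).
have c0 (x : R) (c : bool) : 0 <= x -> 0 <= x * c%:R by move=> x0; rewrite mulr_ge0.
have bs0 : 0 <= (if b then s else r) by case: b => //; exact: ltW.
rewrite nneseriesD; last 2 first.
- by move=> t _ _; rewrite adde_ge0// mule_ge0// lee_fin c0.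
- by move=> t _ _; rewrite mule_ge0// lee_fin.
rewrite nneseriesD; last 2 first.
- by move=> t _ _; rewrite mule_ge0// lee_fin c0.
- by move=> t _ _; rewrite mule_ge0// lee_fin c0.
rewrite !nneseriesZl//.
by rewrite -!/(visits _ _ _ _) !visitsE.
Qed.

(** The holding probability [r] enters only through the factor [1 - r]; this is why
holding can be removed by dividing all parameters by [1 - r]. *)
Lemma green_eq A n : (1 - r) * green A n =
  ((n == i) && ~~ barrier D n && (n \in A))%:R +
  (~~ barrier D n && (n \in A))%:R * (p * green A (n - 1) + q * green A (n + 1)).
Proof.
have E : green A n = ((n == i) && ~~ barrier D n && (n \in A))%:R + (n \in A)%:R *
  (p * (~~ barrier D n)%:R * green A (n - 1) + q * (~~ barrier D n)%:R * green A (n + 1)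
   + r * green A n).
  apply/EFin_inj; rewrite -visitsE /visits nneseries_shift// (visit0 hX).
  under eq_eseriesr do rewrite visitS.
  rewrite nneseriesZl// sum_running_step EFinD EFinM.
  by rewrite [false == _]eq_sym eqbF_neg.
move: E; have [nA|nA] := boolP (n \in A); case: (barrier D n);
  rewrite /= ?(andbF, andbT, mulr0n, mulr1n) /= => E; try lra;
  by (have -> : green A n = 0 by lra); lra.
Qed.

(** A disjoint union over time, whose probability is a series; its description in
terms of the trajectory is [absorbed_insideE]. *)
Definition absorbed_inside A n : set T := \bigcup_t absorbing X A t n.

Lemma measurable_absorbed_inside A n : measurable (absorbed_inside A n).
Proof. by apply: bigcupT_measurable => t; exact: (measurable_absorbing hX). Qed.

(** A state other than a barrier absorbs from within, at rate [s]; a barrier absorbs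
on entrance from one of its neighbours, or at time 0. *)
Lemma absorbed_inside_prob A n : P (absorbed_inside A n) =
  (((n == i) && barrier D n && (n \in A))%:R + (n \in A)%:R *
  (p * (barrier D n)%:R * green A (n - 1) + q * (barrier D n)%:R * green A (n + 1)
   + s * green A n))%:E.
Proof.
have -> : P (absorbed_inside A n) = (\sum_(0 <= t <oo) P (absorbing X A t n))%E.
  apply: measure_semi_bigcup.
  - by move=> t; exact: (measurable_absorbing hX).
  - have lt t t' w : (t < t')%N -> absorbing X A t n w -> absorbing X A t' n w -> False.
      by move=> tt' [_ [_ Xt]] [/(_ t tt')[_ +] _]; rewrite Xt.
    move=> t t' _ _ [w [Fw Fw']]; apply/eqP.
    by have [tt'|tt'|//] := ltngtP t t'; [case: (lt _ _ _ tt' Fw Fw')|case: (lt _ _ _ tt' Fw' Fw)].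
  - exact: measurable_absorbed_inside.
rewrite nneseries_shift// (absorbing0 hX).
under eq_eseriesr do rewrite absorbingS.
rewrite nneseriesZl// sum_running_step EFinD EFinM.
by rewrite [true == _]eq_sym eqb_id.
Qed.

Lemma absorbed_insideE A n : absorbed_inside A n =
  absorbed_in X [set n] `&` [set w | visited (X^~ w) `<=` A].
Proof.
apply/seteqP; split => [w [t _ [H [An Xw]]]|w [[t [tf H] /= Xn] V]].
  split; first by exists t; [split; [rewrite /= Xw|move=> u /H[]]|rewrite /= Xw].
  move=> _ [u /= Hu <-].
  have [ut|tu|->] := ltngtP u t; last by rewrite Xw.
    by have [] := H u ut.
  by have := Hu t tu; rewrite Xw.
exists t => //; split.
  move=> u ut; split; last exact: H.
  by apply: V; exists u => //= v /ltn_trans/(_ ut); exact: H.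
split; last by rewrite -Xn; case: (X t w) tf => ? [].
by rewrite -Xn; apply: V; exists t.
Qed.

Lemma absorbed_in_inside n : absorbed_in X [set n] = absorbed_inside setT n.
Proof. by rewrite absorbed_insideE; apply/seteqP; split => [w|w []]. Qed.

(** Whatever its state, a running walk is absorbed on the spot with probability
[s]. *)
Lemma running_decay t :
  (P (running X setT t.+1) <= (1 - s)%:E * P (running X setT t))%E.
Proof.
set E := running X setT t; have mE : measurable E by exact: mrun.
pose F := [set w | X t.+1 w = ((X t w).1, true)].
have dF : decided_by X t.+1 F.
  by move=> w w' ww'; rewrite /F /= !ww'.
have mF : measurable F by exact: (decided_measurable hX dF).
have PF : (P (E `&` F) = s%:E * P E)%E.
  apply: (@fiberwise_measure_scale R (int * bool)%type s _ _ P (X t) _ _ _ P (X t)) => //.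
    exact: measurableI.
  move=> [m b].
  transitivity (P (E `&` X t @^-1` [set (m, b)] `&` X t.+1 @^-1` [set (m, true)])).
    congr (P _); apply/seteqP; split => w.
      by move=> [[Ew Fw] /= Xw]; rewrite /F /= Xw in Fw.
    by move=> [[Ew /= Xw] /= Xw']; split => //; split => //; rewrite /F /= Xw Xw'.
  case: b.
    rewrite (_ : E `&` _ = set0) ?set0I ?measure0 ?mule0//.
    by apply/seteqP; split => // w [/(_ t (leqnn _))[_ /negP H] /= Xw]; rewrite Xw in H.
  rewrite (walk_markov hX _ _ (@decided_running _ _ X setT t)).
  by rewrite transition_absorbed.
have : (P (running X setT t.+1) <= P (E `\` F))%E.
  apply: le_measure; rewrite ?inE//; first exact: measurableD.
  move=> w H; split; first by move=> u ut; apply: H; rewrite leqW.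
  by have [_ +] := H t.+1 (leqnn _); rewrite /F /= => /negP + Xw; rewrite Xw.
have : P E = (P (E `\` F) + P (E `&` F))%E by exact: measureDI.
rewrite PF.
have fE : P E \is a fin_num by exact: fin_num_measure.
have fD : P (E `\` F) \is a fin_num by apply: fin_num_measure => //; exact: measurableD.
rewrite -(fineK fE) -(fineK fD) -!EFinM -EFinD => -[] H.
by move/le_trans; apply; rewrite lee_fin mulrBl mul1r lerBrDr -H.
Qed.

Lemma never_absorbed0 : P [set w | forall t, ~~ (X t w).2] = 0%E.
Proof.
set N := [set w | _].
have mN : measurable N.
  have -> : N = \bigcap_t (X t @^-1` [set x | ~~ x.2]).
    by apply/seteqP; split => [w Nw t _|w Nw t]; exact: Nw.
  by apply: bigcapT_measurable => t; exact: mst.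
have fE t : P (running X setT t) \is a fin_num by exact: fin_num_measure.
have s1 : 0 <= 1 - s by move: p0 q0 r0 pqrs => *; lra.
have bd t : (P N <= ((1 - s) ^+ t * 1)%:E)%E.
  apply: (@le_trans _ _ (P (running X setT t))).
    by apply: le_measure; rewrite ?inE.
  elim: t => [|t IH]; first by rewrite mul1r; exact: probability_le1.
  apply: le_trans (running_decay t) _.
  by rewrite exprS -mulrA EFinM; apply: lee_wpmul2l; rewrite ?lee_fin.
have fN : P N \is a fin_num by exact: fin_num_measure.
have cv : (1 - s) ^+ t * 1 @[t --> \oo] --> (0 : R) * 1.
  apply: cvgM; last exact: cvg_cst.
  by apply: cvg_expr; rewrite ger0_norm//; move: s0 => *; lra.
rewrite -(fineK fN); congr (_%:E); apply/eqP; rewrite eq_le fine_ge0// andbT.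
rewrite -(mul0r (1 : R)); apply: (cvgr_to_ge cv).
by apply: nearW => t; rewrite -lee_fin fineK.
Qed.

End walk_green.

(** * Uniqueness of the Green function; the final state *)

Section absorption.
Context (R : realType) (p q r s : R) (D : domain) (i : int).
Hypothesis params : walk_parameters p q r s.
Let p0 : 0 <= p. Proof. by case: params. Qed.
Let q0 : 0 <= q. Proof. by case: params. Qed.
Let s0 : 0 < s. Proof. by case: params. Qed.
Let pqrs : p + q + r + s = 1. Proof. by case: params. Qed.
Context d (T : measurableType d) (P : probability T R) (X : nat -> T -> status).
Hypothesis hX : is_walk p q r s D i P X.

(** The difference of two bounded solutions is a bounded subaverage with weights
[p / (1 - r)] and [q / (1 - r)], whose sum is less than 1 because [s > 0]. *)
Lemma green_unique (A : set int) (h : int -> R) (K : R) :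
  (forall n, `|h n| <= K) ->
  (forall n, (1 - r) * h n = ((n == i) && ~~ barrier D n && (n \in A))%:R +
    (~~ barrier D n && (n \in A))%:R * (p * h (n - 1) + q * h (n + 1))) ->
  forall n, h n = green P X A n.
Proof.
move=> hK hE n; apply/eqP; rewrite -subr_eq0; apply/eqP.
have r1 : 0 < 1 - r by move: p0 q0 s0 pqrs => *; lra.
have G0 := green_ge0 params hX A.
have G1 := green_le params hX A.
have GE := green_eq params hX A.
apply: (@bounded_subaverage_eq0 R (p / (1 - r)) (q / (1 - r)) (K + s^-1)
  (fun m => h m - green P X A m)).
- by rewrite divr_ge0// ltW.
- by rewrite divr_ge0// ltW.
- by rewrite -mulrDl ltr_pdivrMr//; move: s0 pqrs => *; lra.
- move=> m; apply: le_trans (ler_normB _ _) _.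
  by rewrite lerD// ger0_norm.
move=> m; rewrite mulrAC [q / _ * _]mulrAC -mulrDl ler_pdivlMr//.
rewrite -[X in _ * X](gtr0_norm r1) -normrM mulrBl ![_ * (1 - r)]mulrC hE GE.
have -> (a b x y : R) : a + b * x - (a + b * y) = b * (x - y) by ring.
have -> (x y z t : R) : p * x + q * y - (p * z + q * t) = p * (x - z) + q * (y - t) by ring.
rewrite normrM; apply: (@le_trans _ _ (1 * `|p * (h (m - 1) - green P X A (m - 1))
   + q * (h (m + 1) - green P X A (m + 1))|)).
  by apply: ler_wpM2r => //; rewrite normr_nat lern1; case: (_ && _).
rewrite mul1r; apply: le_trans (ler_normD _ _) _.
by rewrite !normrM (ger0_norm p0) (ger0_norm q0).
Qed.

Definition final_state (w : T) : int := final_position (X^~ w).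

Let never := [set w | forall t, ~~ (X t w).2].

Lemma absorbed_at_inj (x : nat -> status) t t' : absorbed_at x t -> absorbed_at x t' -> t = t'.
Proof.
move=> [xt ht] [xt' ht']; have [tt'|tt'|//] := ltngtP t t'.
  by have := ht' t tt'; rewrite xt.
by have := ht t' tt'; rewrite xt'.
Qed.

Lemma absorbed_or_never w : never w \/ exists t, absorbed_at (X^~ w) t.
Proof.
have [ex|nex] := pselect (exists t, (X t w).2).
  right; exists (ex_minn ex); case: ex_minnP => t Xt mint; split => // u ut.
  by apply/negP => /mint; rewrite leqNgt ut.
by left => t; apply/negP => Xt; apply: nex; exists t.
Qed.

Lemma final_stateE w t : absorbed_at (X^~ w) t -> final_state w = (X t w).1.
Proof.
by move=> wt; rewrite /final_state /final_position; case: xgetP => [t' _ /absorbed_at_inj/(_ wt)->//|/(_ t)].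
Qed.

Lemma final_state_never w : never w -> final_state w = (X 0%N w).1.
Proof.
move=> Nw; rewrite /final_state /final_position; case: xgetP => [t _ [Xt _]|//].
by have := Nw t; rewrite Xt.
Qed.

Let measurable_never : measurable never.
Proof.
have -> : never = \bigcap_t (X t @^-1` [set x | ~~ x.2]).
  by apply/seteqP; split => [w Nw t _|w Nw t]; exact: Nw.
by apply: bigcapT_measurable => t; exact: (measurable_walk_status hX).
Qed.

(** The last, null, part comes from the trajectories that are never absorbed, for
which [final_position] is read at the default time 0. *)
Lemma final_state_fiber n : final_state @^-1` [set n] =
  absorbed_inside X setT n `|` (never `&` X 0%N @^-1` [set x | x.1 = n]).
Proof.
rewrite absorbed_insideE; apply/seteqP; split => [w /= <-|w /= [[[t wt <-] _]|[Nw <-]]].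
- have [Nw|[t wt]] := absorbed_or_never w.
    by right; split => //; rewrite (final_state_never Nw).
  by left; split => //; exists t => //=; rewrite (final_stateE wt).
- exact: final_stateE wt.
- exact: final_state_never.
Qed.

Lemma measurable_final_state n : measurable (final_state @^-1` [set n]).
Proof.
rewrite final_state_fiber; apply: measurableU.
  exact: (measurable_absorbed_inside hX).
by apply: measurableI => //; exact: (measurable_walk_status hX 0 [set x | x.1 = n]).
Qed.

Definition confined (A : set int) : set T := [set w | visited (X^~ w) `<=` A].

Lemma measurable_confined A : measurable (confined A).
Proof.
pose F t := [set w | (forall u, (u < t)%N -> ~~ (X u w).2) -> A (X t w).1].
have -> : confined A = \bigcap_t F t.
  apply/seteqP; split => [w Vw t _ H|w Fw _ [t H <-]]; last exact: Fw.
  by apply: Vw; exists t.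
apply: bigcapT_measurable => t; apply: (decided_measurable hX (t := t)).
move=> w w' ww' Fw H; rewrite -ww'//; apply: Fw => u ut.
by rewrite ww' ?(ltnW ut)//; exact: H.
Qed.

(** The two events differ only by trajectories that are never absorbed. *)
Lemma confined_final_state A n :
  P (confined A `&` final_state @^-1` [set n]) = P (absorbed_inside X A n).
Proof.
have mC := measurable_confined A.
have mf := measurable_final_state n.
have mA := measurable_absorbed_inside hX A n.
apply: le_anti; apply/andP; split; last first.
  apply: le_measure; rewrite ?inE//; first exact: measurableI.
  rewrite absorbed_insideE => w [[t wt Xn] V]; split => //.
  by rewrite /= (final_stateE wt).
have N0 : P never = 0%E by exact: (never_absorbed0 params hX).
apply: (@le_trans _ _ (P (absorbed_inside X A n `|` never))).
  apply: le_measure; rewrite ?inE//; [exact: measurableI|exact: measurableU|].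
  rewrite absorbed_insideE => w [Cw /= fw].
  have [Nw|[t wt]] := absorbed_or_never w; [by right|left; split => //].
  by exists t => //=; rewrite -(final_stateE wt).
apply: le_trans (measureU2 _ _ _) _ => //.
by rewrite [X in (_ + X)%E]N0 adde0.
Qed.

End absorption.

(** * Comparison with the conjugate walk *)

(** Dynkin's pi-lambda argument, with measurability of the preimages carried along
so that it need only be known on the generators. *)
Lemma eq_law_generator (R : realType) d (T : measurableType d) (P : probability T R)
    d' (T' : measurableType d') (P' : probability T' R) e (U : measurableType e)
    (G : set (set U)) (f : T -> U) (f' : T' -> U) :
  @measurable _ U = <<s G >> -> setI_closed G ->
  (forall B, G B -> [/\ measurable (f @^-1` B), measurable (f' @^-1` B)
                      & P (f @^-1` B) = P' (f' @^-1` B)]) ->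
  forall B, measurable B -> P (f @^-1` B) = P' (f' @^-1` B).
Proof.
move=> GE GI GP B mB.
pose Q := [set B | [/\ measurable (f @^-1` B), measurable (f' @^-1` B)
                      & P (f @^-1` B) = P' (f' @^-1` B)]].
suff: Q B by case.
apply: (dynkin_induction GE GI) => [|//|S _ [m m' E]|F _ tF QF|].
- by split; rewrite ?preimage_setT ?probability_setT.
- split; [exact: (measurableC m)|exact: (measurableC m')|].
  change (P (~` (f @^-1` S)) = P' (~` (f' @^-1` S))).
  by rewrite [LHS]probability_setC// [RHS]probability_setC// E.
- split; rewrite ?preimage_bigcup.
  + by apply: bigcupT_measurable => n; case: (QF n).
  + by apply: bigcupT_measurable => n; case: (QF n).
  have trv (V : Type) (g : V -> U) : trivIset setT (fun n => g @^-1` F n).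
    by move=> n k _ _ [w [Fn Fk]]; apply: (tF n k I I); exists (g w).
  rewrite !measure_semi_bigcup//; try by move=> n; case: (QF n).
  + by apply: eq_eseriesr => n _; case: (QF n).
  + by apply: bigcupT_measurable => n; case: (QF n).
  + by apply: bigcupT_measurable => n; case: (QF n).
- by rewrite -GE.
Qed.

(** The positive and the negative part are transported separately, each being an
integral for the common law; so the equality also covers infinite and undefined
expectations. *)
Lemma eq_law_expectation (R : realType) d (T : measurableType d) (P : probability T R)
    d' (T' : measurableType d') (P' : probability T' R) (Z : T -> R) (Z' : T' -> R) :
  measurable_fun setT Z -> measurable_fun setT Z' ->
  (forall B, measurable B -> P (Z @^-1` B) = P' (Z' @^-1` B)) ->
  ('E_P[Z] = 'E_P'[Z'])%E.
Proof.
move=> mZ mZ' law.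
have ge0 (g : R -> \bar R) : measurable_fun setT g -> (forall x, 0 <= g x)%E ->
    (\int[P]_w g (Z w) = \int[P']_w g (Z' w))%E.
  move=> mg g0.
  rewrite -[LHS](@ge0_integral_pushforward _ _ _ _ _ Z mZ P setT g)//.
  rewrite -[RHS](@ge0_integral_pushforward _ _ _ _ _ Z' mZ' P' setT g)//.
  by apply: eq_measure_integral => B mB _; exact: law.
rewrite unlock integralE [RHS]integralE.
have mE : measurable_fun setT (EFin : R -> \bar R) by exact: EFin_measurable.
rewrite unlock /=; congr (_ - _)%E.
  have := ge0 _ (measurable_funepos mE) (funepos_ge0 _).
  by rewrite unlock.
have := ge0 _ (measurable_funeneg mE) (funeneg_ge0 _).
by rewrite unlock.
Qed.

Lemma setI_closed_ereal_itvc (R : realType) : setI_closed (@ErealGenCInfty.G R).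
Proof.
move=> _ _ [x ->] [y ->]; exists (Num.max x y).
apply/seteqP; split => z /=; rewrite !in_itv /= !andbT EFin_max ge_max.
  by move=> [-> ->].
by move=> /andP[].
Qed.

Lemma setI_closed_ereal_itvo (R : realType) : setI_closed (@ErealGenOInfty.G R).
Proof.
move=> _ _ [x ->] [y ->]; exists (Num.max x y).
apply/seteqP; split => z /=; rewrite !in_itv /= !andbT EFin_max gt_max.
  by move=> [-> ->].
by move=> /andP[].
Qed.

Section absorption_time.
Context (R : realType) (p q r s : R) (D : domain) (i : int).
Context d (T : measurableType d) (P : probability T R) (X : nat -> T -> status).
Hypothesis hX : is_walk p q r s D i P X.

(** The absorption time counts the time units during which the walk is running. *)
Lemma absorption_time_series (w : T) :
  absorption_time R (X^~ w) = (\sum_(0 <= t <oo) (\1_(running X setT t) w)%:E)%E.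
Proof.
have [Nw|[t wt]] := absorbed_or_never X w.
  rewrite /absorption_time (_ : absorbed_at _ = set0); last first.
    by apply/seteqP; split => // t [Xt _]; have := Nw t; rewrite Xt.
  rewrite image_set0 ereal_inf0.
  rewrite (eq_eseriesr (g := fun=> 1%E)); last first.
    by move=> t _; rewrite indicE mem_set.
  apply/esym/eqyP => a a0.
  apply: le_trans (nneseries_lim_ge (Num.truncn a).+1 _) => //.
  rewrite sumEFin big_const_nat subn0 iter_addr_0 lee_fin.
  exact/ltW/truncnS_gt.
have -> : absorption_time R (X^~ w) = (t%:R)%:E.
  rewrite /absorption_time (_ : absorbed_at _ = [set t]) ?image_set1 ?ereal_inf1//.
  by apply/seteqP; split => [t' wt'|_ ->//]; exact: absorbed_at_inj wt' wt.
rewrite (nneseries_split 0 t)// add0n.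
rewrite [X in (_ + X)%E]eseries0 => [|u tu _]; last first.
  rewrite indicE memNset// => /(_ t tu)[_]; by case: wt => ->.
rewrite adde0 (eq_big_nat _ _ (F2 := fun=> 1%E)) => [|u /andP[_ ut]]; last first.
  rewrite indicE mem_set// => v vu; split => //.
  by case: wt => _; apply; exact: leq_ltn_trans ut.
by rewrite sumEFin big_const_nat subn0 iter_addr_0.
Qed.

Lemma expected_absorption_time :
  (\int[P]_w absorption_time R (X^~ w) = \sum_(0 <= t <oo) P (running X setT t))%E.
Proof.
under eq_integral do rewrite absorption_time_series.
have mr t : measurable (running X setT t) := measurable_running hX setT t.
rewrite integral_nneseries//.
  by apply: eq_eseriesr => t _; rewrite integral_indic// setIT.
by move=> t; apply/measurable_EFinP.
Qed.

(** The visits to the status of code [j]; summing over codes instead of states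
makes the exchange of sums below one of series over the natural numbers. *)
Definition visits_code (j : nat) : \bar R :=
  (\sum_(0 <= t <oo) P (running X setT t `&` [set w | pickle (X t w : int * bool) = j]))%E.

Lemma sum_running_code :
  (\sum_(0 <= t <oo) P (running X setT t) = \sum_(0 <= j <oo) visits_code j)%E.
Proof.
rewrite /visits_code nneseries_interchange//.
apply: eq_eseriesr => t _.
have mr : measurable (running X setT t) := measurable_running hX setT t.
exact: (@measure_fibers _ _ (int * bool)%type _ (fun k => measurable_walk_status hX t [set k])).
Qed.

Lemma visits_codeE j : visits_code j =
  if pickle_inv j is Some (n, false) then visits P X setT n else 0%E.
Proof.
rewrite /visits_code /visits.
case Ej : (pickle_inv j : option (int * bool)) => [[n []]|].
- apply: eseries0 => t _ _; rewrite (_ : _ `&` _ = set0) ?measure0//.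
  apply/seteqP; split => // w [/(_ t (leqnn _))[_ /negP H] /= Xw].
  by apply: H; move: Ej; rewrite -Xw pickleK_inv => -[] ->.
- apply: eq_eseriesr => t _; congr (P (_ `&` _)).
  apply/seteqP; split => w /= Xw; first by move: Ej; rewrite -Xw pickleK_inv => -[] ->.
  by have := @pickle_invK (int * bool)%type j; rewrite Ej /= Xw.
- apply: eseries0 => t _ _; rewrite (_ : _ `&` _ = set0) ?measure0//.
  by apply/seteqP; split => // w [_ /= Xw]; move: Ej; rewrite -Xw pickleK_inv.
Qed.

End absorption_time.

Section conjugate.
Context (R : realType) (p q r s : R) (D : domain) (i : int).
Hypothesis params : walk_parameters p q r s.
Context d (T : measurableType d) (P : probability T R) (X : nat -> T -> status).
Hypothesis hX : is_walk p q r s D i P X.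
Context d' (T' : measurableType d') (P' : probability T' R) (X' : nat -> T' -> status).
Hypothesis hX' : is_walk (p / (1 - r)) (q / (1 - r)) 0 (s / (1 - r)) D i P' X'.

Let r1 : 0 < 1 - r. Proof. by case: params => *; lra. Qed.

Lemma conjugate_parameters : walk_parameters (p / (1 - r)) (q / (1 - r)) 0 (s / (1 - r)).
Proof.
case: params => p0 q0 r0 s0 pqrs; have r1' := ltW r1.
split; [exact: divr_ge0|exact: divr_ge0|by []|exact: divr_gt0|].
rewrite addr0 -!mulrDl (_ : p + q + s = 1 - r) ?divff ?gt_eqF//; last lra.
Qed.

Let params' := conjugate_parameters.

(** [(1 - r) * green P X A] is bounded and solves the equation of the conjugate
walk: a visit of the conjugate walk stands for a whole stay of the original
one, of mean duration [(1 - r)^-1]. *)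
Lemma green_conjugate A n : green P' X' A n = (1 - r) * green P X A n.
Proof.
have rn0 : 1 - r != 0 by rewrite gt_eqF.
apply/esym/(green_unique params' hX' (h := fun n => (1 - r) * green P X A n) (K := (1 - r) * s^-1)).
  move=> m; rewrite ger0_norm ?ler_pM2l ?(green_le params hX)//.
  by rewrite mulr_ge0 ?(green_ge0 params hX)// ltW.
move=> m; rewrite subr0 mul1r (green_eq params hX); congr (_ + _ * _).
by field.
Qed.

(** The factor [1 - r] gained by the visits cancels the denominators of the
conjugate parameters. *)
Lemma absorbed_inside_conjugate A n :
  P' (absorbed_inside X' A n) = P (absorbed_inside X A n).
Proof.
have rn0 : 1 - r != 0 by rewrite gt_eqF.
rewrite (absorbed_inside_prob params' hX') (absorbed_inside_prob params hX) !green_conjugate.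
by congr (_%:E); congr (_ + _ * _); field.
Qed.

Lemma confined_conjugate A : P' (confined X' A) = P (confined X A).
Proof.
rewrite -[RHS]mul1e; apply: (fiberwise_measure_scale (Y := final_state X) (Y' := final_state X')).
- exact: (measurable_final_state hX).
- exact: (measurable_final_state hX').
- exact: (measurable_confined hX).
- exact: (measurable_confined hX').
- move=> n; rewrite mul1e.
  rewrite [LHS](confined_final_state params' hX') [RHS](confined_final_state params hX).
  exact: absorbed_inside_conjugate.
Qed.

Lemma final_state_conjugate (B : set int) :
  P' (final_state X' @^-1` B) = P (final_state X @^-1` B).
Proof.
have mf := measurable_preimage_countType (measurable_final_state hX).
have mf' := measurable_preimage_countType (measurable_final_state hX').
rewrite -[RHS]mul1e; apply: (fiberwise_measure_scale (Y := final_state X) (Y' := final_state X')).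
- exact: (measurable_final_state hX).
- exact: (measurable_final_state hX').
- exact: mf.
- exact: mf'.
- move=> n; rewrite mul1e.
  have [nB|nB] := pselect (B n); last first.
    have f0 (U : Type) (g : U -> int) : g @^-1` B `&` g @^-1` [set n] = set0.
      by apply/seteqP; split => // w [/= + gw]; rewrite gw.
    by rewrite (f0 _ (final_state X)) (f0 _ (final_state X')) !measure0.
  have fE (U : Type) (g : U -> int) : g @^-1` B `&` g @^-1` [set n] = setT `&` g @^-1` [set n].
    by apply/seteqP; split => w [_ /= gw]; split => //=; rewrite gw.
  rewrite (fE _ (final_state X)) (fE _ (final_state X')).
  have -> : [set: T] = confined X setT by apply/seteqP; split.
  have -> : [set: T'] = confined X' setT by apply/seteqP; split.
  rewrite [LHS](confined_final_state params' hX') [RHS](confined_final_state params hX).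
  exact: absorbed_inside_conjugate.
Qed.

Lemma absorbed_in_conjugate n : P' (absorbed_in X' [set n]) = P (absorbed_in X [set n]).
Proof.
by rewrite !absorbed_in_inside absorbed_inside_conjugate.
Qed.

(** The minimum is at least [x] if and only if the walk is confined to the states
that are at least [x], and these rays generate the Borel sets. *)
Lemma walk_min_law (B : set (\bar R)) : measurable B ->
  P ((fun w => walk_min R (X^~ w)) @^-1` B) = P' ((fun w => walk_min R (X'^~ w)) @^-1` B).
Proof.
apply: (eq_law_generator (ErealGenCInfty.measurableE R)); first exact: setI_closed_ereal_itvc.
move=> _ [x ->].
have E (U : Type) (Y : nat -> U -> status) :
    (fun w => walk_min R (Y^~ w)) @^-1` `[x%:E, +oo[ = [set w | visited (Y^~ w) `<=` [set n | x <= n%:~R]].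
  apply/seteqP; split => w /=; rewrite in_itv /= andbT.
    by move=> /ereal_infP H n vn /=; rewrite -lee_fin; apply: H; exists n.
  by move=> H; apply/ereal_infP => _ [n vn <-]; rewrite lee_fin; exact: H.
rewrite !E -!/(confined _ _); split.
- exact: (measurable_confined hX).
- exact: (measurable_confined hX').
- by rewrite confined_conjugate.
Qed.

Lemma walk_max_law (B : set (\bar R)) : measurable B ->
  P ((fun w => walk_max R (X^~ w)) @^-1` B) = P' ((fun w => walk_max R (X'^~ w)) @^-1` B).
Proof.
apply: (eq_law_generator (ErealGenOInfty.measurableE R)); first exact: setI_closed_ereal_itvo.
move=> _ [x ->].
have E (U : Type) (Y : nat -> U -> status) :
    (fun w => walk_max R (Y^~ w)) @^-1` `]x%:E, +oo[ = ~` [set w | visited (Y^~ w) `<=` [set n | n%:~R <= x]].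
  rewrite -[LHS]setCK; congr (~` _).
  apply/seteqP; split => w /=; rewrite in_itv /= andbT.
    move=> /negP; rewrite -leNgt => /ereal_supP H n vn /=.
    by rewrite -lee_fin; apply: H; exists n.
  by move=> H; apply/negP; rewrite -leNgt; apply/ereal_supP => _ [n vn <-]; rewrite lee_fin; exact: H.
have mC := measurable_confined hX [set n | n%:~R <= x].
have mC' := measurable_confined hX' [set n | n%:~R <= x].
rewrite !E -!/(confined _ _); split.
- exact: measurableC.
- exact: measurableC.
- by rewrite [LHS]probability_setC// [RHS]probability_setC// confined_conjugate.
Qed.

Lemma expected_final_position_conjugate :
  ('E_P[fun w => (final_position (X^~ w))%:~R] = 'E_P'[fun w => (final_position (X'^~ w))%:~R])%E.
Proof.
have mf := measurable_preimage_countType (measurable_final_state hX).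
have mf' := measurable_preimage_countType (measurable_final_state hX').
apply: eq_law_expectation => [_ B _|_ B _|B _].
- by rewrite setTI; exact: (mf [set n | B n%:~R]).
- by rewrite setTI; exact: (mf' [set n | B n%:~R]).
- exact/esym/(final_state_conjugate [set n | B n%:~R]).
Qed.

(** The expected absorption time is the total number of visits, over all states. *)
Lemma expected_absorption_time_conjugate :
  (\int[P']_w absorption_time R (X'^~ w) = (1 - r)%:E * \int[P]_w absorption_time R (X^~ w))%E.
Proof.
rewrite (expected_absorption_time hX) (expected_absorption_time hX').
rewrite (sum_running_code hX) (sum_running_code hX') -nneseriesZl; last first.
  by move=> j _; exact: nneseries_ge0.
apply: eq_eseriesr => j _; rewrite !visits_codeE.
case: (pickle_inv j) => [[n []]|]; rewrite ?mule0//.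
by rewrite (visitsE params' hX') (visitsE params hX) green_conjugate EFinM.
Qed.

End conjugate.

(** * The walk on the whole line *)

Section characteristic_roots.
Context (R : realType).
Implicit Types p q s : R.

(** The square root of the discriminant of [q * z ^+ 2 - (p + q + s) * z + p], the characteristic
polynomial of the equation for visits on the line; [ratio p q s] is its root in
[(0, 1)], and exchanging [p] and [q] gives the inverse of the other root. *)
Definition discr p q s : R := Num.sqrt ((p - q) ^+ 2 + 2 * (p + q) * s + s ^+ 2).

Definition ratio p q s : R := (p + q + s - discr p q s) / (2 * q).

Lemma discrC p q s : discr p q s = discr q p s.
Proof. by rewrite /discr; congr Num.sqrt; ring. Qed.

Lemma discr_sqr p q s : 0 < p -> 0 < q -> 0 < s ->
  discr p q s ^+ 2 = (p - q) ^+ 2 + 2 * (p + q) * s + s ^+ 2.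
Proof.
move=> p0 q0 s0; rewrite sqr_sqrtr//.
by rewrite !addr_ge0 ?sqr_ge0// ?mulr_ge0 ?addr_ge0// ltW.
Qed.

Lemma discr_gt p q s : 0 < p -> 0 < q -> 0 < s -> `|p - q| < discr p q s.
Proof.
move=> p0 q0 s0; rewrite -(@ltr_pXn2r _ 2)// ?nnegrE ?sqrtr_ge0// discr_sqr//.
rewrite real_normK ?num_real// -addrA ltrDl addr_gt0 ?exprn_gt0//.
by rewrite !mulr_gt0// addr_gt0.
Qed.

Lemma discr_gt0 p q s : 0 < p -> 0 < q -> 0 < s -> 0 < discr p q s.
Proof. by move=> p0 q0 s0; exact: le_lt_trans (discr_gt p0 q0 s0). Qed.

Lemma ratio_gt0 p q s : 0 < p -> 0 < q -> 0 < s -> 0 < ratio p q s.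
Proof.
move=> p0 q0 s0; rewrite divr_gt0 ?mulr_gt0// subr_gt0.
have D2 := discr_sqr p0 q0 s0; have := discr_gt0 p0 q0 s0 => D0.
rewrite -(@ltr_pXn2r _ 2)// ?nnegrE ?ltW// ?addr_gt0// D2.
have : 0 < p * q by rewrite mulr_gt0.
nra.
Qed.

Lemma ratio_lt1 p q s : 0 < p -> 0 < q -> 0 < s -> ratio p q s < 1.
Proof.
move=> p0 q0 s0; rewrite ltr_pdivrMr ?mulr_gt0// mul1r.
suff : p - q + s < discr p q s by lra.
have D2 := discr_sqr p0 q0 s0; have D0 := discr_gt0 p0 q0 s0.
have : 0 < q * s by rewrite mulr_gt0.
have [n0|n0] := lerP (p - q + s) 0; first by move=> _; exact: le_lt_trans D0.
move=> qs; rewrite -(@ltr_pXn2r _ 2)// ?nnegrE ?ltW// D2.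
nra.
Qed.

Lemma ratio_root p q s : 0 < p -> 0 < q -> 0 < s ->
  (p + q + s) * ratio p q s = p + q * ratio p q s ^+ 2.
Proof.
move=> p0 q0 s0; have D2 := discr_sqr p0 q0 s0.
have q0' : q != 0 by rewrite gt_eqF.
rewrite /ratio; set D := discr p q s in D2 *.
have -> : q * ((p + q + s - D) / (2 * q)) ^+ 2 =
  ((p + q + s) ^+ 2 - 2 * (p + q + s) * D + D ^+ 2) / (4 * q) by field.
by rewrite D2; field.
Qed.

(** By rationalization.  The left-hand side is the sum of the geometric series of
ratio [ratio p q s] without its first term, as it occurs on a ray. *)
Lemma ratio_odds p q s : 0 < p -> 0 < q -> 0 < s ->
  ratio p q s / (1 - ratio p q s) = (discr p q s + (p - q) - s) / (2 * s).
Proof.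
move=> p0 q0 s0; have D2 := discr_sqr p0 q0 s0.
have a1 : 1 - ratio p q s != 0 by rewrite gt_eqF// subr_gt0 ratio_lt1.
have s2 : 2 * s != 0 by rewrite mulf_neq0 ?gt_eqF.
apply/eqP; rewrite eqr_div//; apply/eqP.
rewrite /ratio; set D := discr p q s in D2 *.
have q2 : 2 * q != 0 by rewrite mulf_neq0 ?gt_eqF.
apply: (mulIf q2).
have -> : (D + (p - q) - s) * (1 - (p + q + s - D) / (2 * q)) * (2 * q) =
    D ^+ 2 - (p - q) ^+ 2 + s ^+ 2 - 2 * s * D by field; rewrite gt_eqF.
by rewrite D2; field; rewrite gt_eqF.
Qed.

End characteristic_roots.

Lemma nneseries_geometric (R : realType) (a z : R) : `|z| < 1 ->
  (\sum_(0 <= k <oo) (a * z ^+ k)%:E = (a / (1 - z))%:E)%E.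
Proof.
move=> z1; apply/cvg_lim => //.
rewrite (_ : (fun n => _) = EFin \o series (geometric a z)); last first.
  by apply/funext => n; rewrite /= sumEFin.
apply: cvg_EFin; first by apply: nearW.
exact: cvg_geometric_series.
Qed.

Section line.
Context (R : realType) (p q r s : R).
Hypotheses (p0 : 0 < p) (q0 : 0 < q) (r0 : 0 <= r) (s0 : 0 < s) (pqrs : p + q + r + s = 1).
Context d (T : measurableType d) (P : probability T R) (X : nat -> T -> status).
Hypothesis hX : is_walk p q r s Line 0 P X.

Let params : walk_parameters p q r s.
Proof. by split => //; exact: ltW. Qed.

(** Green function of the walk on the line: the bounded solution is geometric on
both sides of the starting state 0, where the source term fixes the factor
[(discr p q s)^-1]. *)
Definition line_green (n : int) : R :=
  match n with
  | Posz k => ratio p q s ^+ k / discr p q s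
  | Negz k => ratio q p s ^+ k.+1 / discr p q s
  end.

Lemma green_line n : green P X setT n = line_green n.
Proof.
have D0 := discr_gt0 p0 q0 s0.
have D0' : discr p q s != 0 by rewrite gt_eqF.
have [[a0 a1] aE] := (ratio_gt0 p0 q0 s0, ratio_lt1 p0 q0 s0, ratio_root p0 q0 s0).
have [[b0 b1] bE] := (ratio_gt0 q0 p0 s0, ratio_lt1 q0 p0 s0, ratio_root q0 p0 s0).
have r1 : 1 - r = p + q + s by rewrite -pqrs; ring.
apply/esym; move: n; apply: (green_unique params hX (h := line_green) (K := (discr p q s)^-1)) => n.
  have bd (z : R) k : 0 < z -> z < 1 -> `|z ^+ k / discr p q s| <= (discr p q s)^-1.
    move=> z0 z1; rewrite ger0_norm ?mulr_ge0 ?invr_ge0 ?exprn_ge0// ?(ltW z0) ?(ltW D0)//.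
    by rewrite ler_piMl ?invr_ge0 ?(ltW D0)// exprn_ile1// ltW.
  by case: n => k; exact: bd.
rewrite in_setT /= !andbT mul1r r1.
case: n => [[|k]|[|k]].
- rewrite eqxx sub0r add0r /= expr0 !expr1.
  rewrite /ratio (discrC q p); field.
  by rewrite !gt_eqF.
- have -> : k.+1%:Z - 1 = k%:Z by lia.
  have -> : k.+1%:Z + 1 = k.+2%:Z by lia.
  rewrite /= add0r !exprS.
  have -> : (p + q + s) * (ratio p q s * ratio p q s ^+ k / discr p q s) =
     ((p + q + s) * ratio p q s) * ratio p q s ^+ k / discr p q s by ring.
  by rewrite aE; ring.
- have -> : Negz 0 - 1 = Negz 1 by lia.
  have -> : Negz 0 + 1 = 0%:Z by lia.
  rewrite /= add0r expr0 expr1.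
  have -> : (p + q + s) * (ratio q p s / discr p q s) =
     ((q + p + s) * ratio q p s) / discr p q s by ring.
  by rewrite bE; ring.
- have -> : Negz k.+1 - 1 = Negz k.+2 by lia.
  have -> : Negz k.+1 + 1 = Negz k by lia.
  rewrite /= add0r !exprS.
  have -> : (p + q + s) * (ratio q p s * (ratio q p s * ratio q p s ^+ k) / discr p q s) =
     ((q + p + s) * ratio q p s) * (ratio q p s * ratio q p s ^+ k) / discr p q s by ring.
  by rewrite bE; ring.
Qed.

Lemma absorbed_in_line n : P (absorbed_in X [set n]) = (s * line_green n)%:E.
Proof.
rewrite absorbed_in_inside (absorbed_inside_prob params hX) !green_line in_setT /=.
by rewrite andbF /= !mulr0 !mul0r !add0r mul1r.
Qed.

(** Common to the two rays, enumerated outwards by [g]. *)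
Lemma absorbed_in_ray (g : nat -> int) (A : set int) (z : R) :
  injective g -> range g = A -> 0 < z -> z < 1 ->
  (forall k, line_green (g k) = z ^+ k.+1 / discr p q s) ->
  P (absorbed_in X A) = (s / discr p q s * (z / (1 - z)))%:E.
Proof.
move=> gI gA z0 z1 gE.
have -> : absorbed_in X A = \bigcup_k absorbed_in X [set g k].
  apply/seteqP; split => [w [t wt]|w [k _ [t wt /= Xw]]].
    by rewrite -gA => -[k _ gk]; exists k => //; exists t.
  by exists t => //; rewrite -gA Xw; exists k.
have mk k : measurable (absorbed_in X [set g k]).
  by rewrite absorbed_in_inside; exact: (measurable_absorbed_inside hX).
have -> : P (\bigcup_k absorbed_in X [set g k]) =
    (\sum_(0 <= k <oo) P (absorbed_in X [set g k]))%E.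
  apply: measure_semi_bigcup => //; last exact: bigcupT_measurable.
  move=> k k' _ _ [w [[t wt /= tk] [t' wt' /= tk']]].
  by apply: gI; rewrite -tk -tk' (absorbed_at_inj wt wt').
rewrite (eq_eseriesr (g := fun k => (s / discr p q s * z * z ^+ k)%:E)); last first.
  by move=> k _; rewrite absorbed_in_line gE exprS; congr (_%:E); ring.
by rewrite nneseries_geometric ?gtr0_norm//; congr (_%:E); ring.
Qed.

Lemma absorbed_in_right : P (absorbed_in X [set n : int | 1 <= n]) =
  ((discr p q s + (p - q) - s) / (2 * discr p q s))%:E.
Proof.
have -> : (discr p q s + (p - q) - s) / (2 * discr p q s) =
    s / discr p q s * (ratio p q s / (1 - ratio p q s)).
  by rewrite ratio_odds//; field; rewrite !gt_eqF// discr_gt0.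
apply: (@absorbed_in_ray (fun k => Posz k.+1)) => //.
- by move=> k k' [].
- apply/seteqP; split => [_ [k _ <-]//|[[|k]|k]//= _].
  by exists k.
- exact: ratio_gt0.
- exact: ratio_lt1.
Qed.

Lemma absorbed_in_left : P (absorbed_in X [set n : int | n <= -1]) =
  ((discr p q s - (p - q) - s) / (2 * discr p q s))%:E.
Proof.
have -> : (discr p q s - (p - q) - s) / (2 * discr p q s) =
    s / discr p q s * (ratio q p s / (1 - ratio q p s)).
  by rewrite ratio_odds// (discrC q p); field; rewrite !gt_eqF// discr_gt0.
apply: (@absorbed_in_ray Negz) => //.
- by move=> k k' [].
- apply/seteqP; split => [_ [k _ <-]//=|[k|k]//= _].
  by exists k.
- exact: ratio_gt0.
- exact: ratio_lt1.
Qed.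

End line.

(** * Limits as the absorption rate tends to 0 *)

Lemma cvg_congr (R : realType) (I : Type) (F : set_system I) (f g : I -> R) (l l' : R) :
  f =1 g -> l = l' -> f x @[x --> F] --> l -> g x @[x --> F] --> l'.
Proof. by move=> /funext -> ->. Qed.

Section drift_limits.
Context (R : realType) (I : Type) (F : set_system I) {FF : ProperFilter F}.
Context (p q s : I -> R) (a b : R).
Hypotheses (p0 : forall x, 0 < p x) (q0 : forall x, 0 < q x) (s0 : forall x, 0 < s x).
Hypothesis qp : forall x, q x < p x.
Hypotheses (a0 : 0 < a) (b0 : 0 < b) (ba : b < a).
Hypotheses (pa : p x @[x --> F] --> a) (qb : q x @[x --> F] --> b) (sc : s x @[x --> F] --> (0 : R)).

Let De x := discr (p x) (q x) (s x).
Let e x := p x - q x.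
(** The difference quotient of [discr] at [s = 0].  All expansions below are exact
identities in [k], whose limit replaces the Taylor expansion of the square
root. *)
Let k x := (De x - e x) / s x.
Let al x := ratio (p x) (q x) (s x).

Let e0 x : 0 < e x. Proof. by rewrite subr_gt0. Qed.
Let De0 x : 0 < De x. Proof. exact: discr_gt0. Qed.
Let en x : e x != 0. Proof. by rewrite gt_eqF. Qed.
Let Den x : De x != 0. Proof. by rewrite gt_eqF. Qed.
Let sn x : s x != 0. Proof. by rewrite gt_eqF. Qed.
Let qn x : q x != 0. Proof. by rewrite gt_eqF. Qed.
Let pn x : p x != 0. Proof. by rewrite gt_eqF. Qed.
Let abn : a - b != 0. Proof. by rewrite gt_eqF// subr_gt0. Qed.
Let bn : b != 0. Proof. by rewrite gt_eqF. Qed.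
Let an : a != 0. Proof. by rewrite gt_eqF. Qed.

Let ce : e x @[x --> F] --> a - b. Proof. exact: cvgB. Qed.

Lemma cvg_discr : De x @[x --> F] --> a - b.
Proof.
have -> : a - b = Num.sqrt ((a - b) ^+ 2 + 2 * (a + b) * 0 + 0 ^+ 2).
  by rewrite mulr0 expr0n /= !addr0 sqrtr_sqr gtr0_norm// subr_gt0.
apply: continuous_cvg; first exact: sqrt_continuous.
apply: cvgD; last exact: (cvgM sc sc).
apply: cvgD; first exact: (cvgM ce ce).
apply: cvgM sc; apply: cvgM; [exact: cvg_cst|exact: cvgD].
Qed.

Let kE x : k x = (2 * (p x + q x) + s x) / (De x + e x).
Proof.
have D2 := discr_sqr (p0 x) (q0 x) (s0 x).
have DeE : De x + e x != 0 by rewrite gt_eqF// addr_gt0.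
apply/eqP; rewrite /k eqr_div//; apply/eqP.
transitivity (De x ^+ 2 - e x ^+ 2); first by ring.
by rewrite /De D2 /e; ring.
Qed.

Lemma cvg_slope : k x @[x --> F] --> (a + b) / (a - b).
Proof.
rewrite (_ : k = fun x => (2 * (p x + q x) + s x) / (De x + e x)); last exact/funext/kE.
have -> : (a + b) / (a - b) = (2 * (a + b) + 0) / ((a - b) + (a - b)).
  have : a - b + (a - b) != 0 by rewrite -mulr2n mulrn_eq0.
  by move=> h; field; rewrite h abn.
apply: cvgM; last first.
  apply: cvgV; first by rewrite -mulr2n mulrn_eq0.
  exact: (cvgD cvg_discr ce).
by apply: cvgD sc; apply: cvgM; [exact: cvg_cst|exact: cvgD].
Qed.

Let alE x : al x = 1 - s x * ((k x - 1) / (2 * q x)).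
Proof.
by rewrite /al /ratio /k -/(De x) /e; field; rewrite sn qn.
Qed.

Let cvg_decay : (1 - al x) / s x @[x --> F] --> (a - b)^-1.
Proof.
rewrite (_ : (fun x => _) = fun x => (k x - 1) / (2 * q x)); last first.
  by apply/funext => x; rewrite alE; field; rewrite sn qn.
have -> : (a - b)^-1 = ((a + b) / (a - b) - 1) / (2 * b).
  by field; rewrite abn bn.
apply: cvgM.
  by apply: cvgB cvg_slope _; exact: cvg_cst.
apply: cvgV; first by rewrite mulf_neq0.
by apply: cvgM => //; exact: cvg_cst.
Qed.

Let cvg_ratio : al x @[x --> F] --> (1 : R).
Proof.
apply: (@cvg_congr _ _ _ (fun x => 1 - s x * ((1 - al x) / s x)) _ (1 - 0 * (a - b)^-1)).
- by move=> x; field.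
- by rewrite mul0r subr0.
by apply: cvgB; [exact: cvg_cst|exact: cvgM].
Qed.

Let cvg_ratioX n : al x ^+ n @[x --> F] --> (1 : R).
Proof.
elim: n => [|n IH]; first by under eq_fun do rewrite expr0; exact: cvg_cst.
under eq_fun do rewrite exprS.
by rewrite -(mulr1 (1 : R)); exact: cvgM.
Qed.

(** As [al] tends to 1, [1 - al ^+ n] is equivalent to [n * (1 - al)]. *)
Let cvg_decayX n : (1 - al x ^+ n) / s x @[x --> F] --> n%:R / (a - b).
Proof.
elim: n => [|n IH].
  under eq_fun do rewrite expr0 subrr mul0r.
  by rewrite mul0r; exact: cvg_cst.
rewrite (_ : (fun x => _) = fun x => (1 - al x ^+ n) / s x + al x ^+ n * ((1 - al x) / s x)); last first.
  by apply/funext => x; rewrite exprS; field.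
rewrite -natr1 mulrDl -(mul1r (1 / (a - b))).
apply: cvgD => //; apply: cvgM => //; by rewrite div1r.
Qed.

Lemma cvg_drift_point n :
  (s x * (al x ^+ n / De x) - s x / (p x - q x) *
     (1 - (n%:R / (p x - q x) + (p x + q x) / (p x - q x) ^+ 2) * s x)) / s x ^+ 2
   @[x --> F] --> (0 : R).
Proof.
rewrite (_ : (fun x => _) = fun x => - ((1 - al x ^+ n) / s x / De x) - k x / (De x * e x)
   + (n%:R / e x + (p x + q x) / e x ^+ 2) / e x); last first.
  apply/funext => x; rewrite -/(e x) /k; field.
  by rewrite sn en Den.
apply: (cvg_congr (l := - (n%:R / (a - b) / (a - b)) - (a + b) / (a - b) / ((a - b) * (a - b))
  + (n%:R / (a - b) + (a + b) / (a - b) ^+ 2) / (a - b)) (fun=> erefl)); first by field.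
have cV := cvgV abn ce.
apply: cvgD.
  apply: cvgB.
    apply: cvgN; apply: cvgM; first exact: cvg_decayX.
    by apply: cvgV => //; exact: cvg_discr.
  apply: cvgM; first exact: cvg_slope.
  by apply: cvgV; [rewrite mulf_neq0|apply: cvgM => //; exact: cvg_discr].
apply: cvgM; last exact: cV.
apply: cvgD; first by apply: cvgM; [exact: cvg_cst|exact: cV].
apply: cvgM; first exact: cvgD.
apply: cvgV; first by rewrite expf_neq0.
exact: (cvgM ce ce).
Qed.

(** The product of the roots of the characteristic polynomial is [p / q]. *)
Lemma ratio_swap x : ratio (q x) (p x) (s x) = q x / p x * al x.
Proof.
by rewrite /al /ratio (discrC (q x)) -/(De x); field; rewrite pn qn.
Qed.

Lemma cvg_drift_point_left n :
  (s x * (ratio (q x) (p x) (s x) ^+ n / De x) - (q x / p x) ^+ n * s x / (p x - q x) *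
     (1 - (n%:R / (p x - q x) + (p x + q x) / (p x - q x) ^+ 2) * s x)) / s x ^+ 2
   @[x --> F] --> (0 : R).
Proof.
have c1 : (q x / p x) ^+ n @[x --> F] --> (b / a) ^+ n.
  elim: n => [|n IH]; first by under eq_fun do rewrite expr0; rewrite expr0; exact: cvg_cst.
  under eq_fun do rewrite exprS.
  by rewrite exprS; apply: cvgM => //; apply: cvgM => //; exact: cvgV.
rewrite (_ : (fun x => _) = fun x => (q x / p x) ^+ n * ((s x * (al x ^+ n / De x) - s x / (p x - q x) *
     (1 - (n%:R / (p x - q x) + (p x + q x) / (p x - q x) ^+ 2) * s x)) / s x ^+ 2)); last first.
  by apply/funext => x; rewrite ratio_swap exprMn; ring.
rewrite -(mulr0 ((b / a) ^+ n)); apply: cvgM => //.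
exact: cvg_drift_point.
Qed.

Lemma cvg_drift_right :
  ((De x + (p x - q x) - s x) / (2 * De x) - (1 - p x * s x / (p x - q x) ^+ 2)) / s x
   @[x --> F] --> (0 : R).
Proof.
apply: (@cvg_congr _ _ _ (fun x => - (k x + 1) / (2 * De x) + p x / e x ^+ 2) _
  (- ((a + b) / (a - b) + 1) / (2 * (a - b)) + a / (a - b) ^+ 2)).
- move=> x; rewrite -/(e x) /k; field.
  by rewrite sn en Den.
- by field.
apply: cvgD.
  apply: cvgM.
    by apply: cvgN; apply: cvgD; [exact: cvg_slope|exact: cvg_cst].
  apply: cvgV; first by rewrite mulf_neq0.
  by apply: cvgM; [exact: cvg_cst|exact: cvg_discr].
apply: cvgM => //; apply: cvgV; first by rewrite expf_neq0.
exact: (cvgM ce ce).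
Qed.

(** [q] is eliminated through [4 * q * s = discr ^+ 2 - (p - q + s) ^+ 2]; this
cancels the terms of order [s^-1] exactly. *)
Lemma cvg_drift_left :
  ((De x - (p x - q x) - s x) / (2 * De x)
     - q x * s x / (p x - q x) ^+ 2 * (1 - (2 * p x + q x) / (p x - q x) ^+ 2 * s x)) / s x ^+ 2
   @[x --> F] --> (0 : R).
Proof.
have ab2 : (a - b) + (a - b) != 0 by rewrite -mulr2n mulrn_eq0.
apply: (@cvg_congr _ _ _ (fun x => - ((k x - 1) / (2 * (De x * (De x + e x))))
   - q x * (3 * (e x * k x) + k x ^+ 2 * s x) / (De x * (De x + e x) * e x ^+ 2)
   + q x * (2 * p x + q x) / (e x ^+ 2 * e x ^+ 2)) _
  (- (((a + b) / (a - b) - 1) / (2 * ((a - b) * (a - b + (a - b)))))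
   - b * (3 * ((a - b) * ((a + b) / (a - b))) + ((a + b) / (a - b)) ^+ 2 * 0)
       / ((a - b) * (a - b + (a - b)) * (a - b) ^+ 2)
   + b * (2 * a + b) / ((a - b) ^+ 2 * (a - b) ^+ 2))).
- move=> x; rewrite -/(e x) /k.
  have := discr_sqr (p0 x) (q0 x) (s0 x); rewrite -/(De x) -/(e x) => D2.
  have DeE : De x + e x != 0 by rewrite gt_eqF// addr_gt0.
  have qE : q x = (De x ^+ 2 - (e x + s x) ^+ 2) / (4 * s x).
    by rewrite D2 /e; field.
  have pE : p x = e x + q x by rewrite /e; ring.
  rewrite pE qE; field.
  by rewrite sn en Den DeE.
- by field; rewrite abn ab2.
have ck : k x @[x --> F] --> (a + b) / (a - b) by exact: cvg_slope.
have cD : De x @[x --> F] --> a - b by exact: cvg_discr.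
have ce2 : e x ^+ 2 @[x --> F] --> (a - b) ^+ 2 by exact: (cvgM ce ce).
have cDe : De x * (De x + e x) @[x --> F] --> (a - b) * (a - b + (a - b)).
  by apply: cvgM => //; exact: cvgD.
apply: cvgD.
  apply: cvgB.
    apply: cvgN; apply: cvgM; first by apply: cvgB => //; exact: cvg_cst.
    apply: cvgV; first by rewrite !mulf_neq0.
    by apply: cvgM; [exact: cvg_cst|exact: cDe].
  apply: cvgM.
    apply: cvgM => //; apply: cvgD.
      by apply: cvgM; [exact: cvg_cst|exact: cvgM].
    by apply: cvgM => //; exact: (cvgM ck ck).
  apply: cvgV; first by rewrite !mulf_neq0// expf_neq0.
  exact: (cvgM cDe ce2).
apply: cvgM.
  apply: cvgM => //; apply: cvgD => //; apply: cvgM; [exact: cvg_cst|exact: pa].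
apply: cvgV; first by rewrite mulf_neq0// expf_neq0.
exact: (cvgM ce2 ce2).
Qed.

End drift_limits.

Section symmetric_limits.
Context (R : realType) (I : Type) (F : set_system I) {FF : ProperFilter F}.
Context (p s : I -> R) (a : R).
Hypotheses (p0 : forall x, 0 < p x) (s0 : forall x, 0 < s x) (a0 : 0 < a).
Hypotheses (pa : p x @[x --> F] --> a) (sc : s x @[x --> F] --> (0 : R)).

Let discr_sym x : discr (p x) (p x) (s x) = Num.sqrt (s x) * Num.sqrt (4 * p x + s x).
Proof.
rewrite -sqrtrM; last exact: ltW.
by rewrite /discr; congr Num.sqrt; ring.
Qed.

(** Without drift, [discr] is [Num.sqrt s * Num.sqrt (4 * p + s)]. *)
Lemma cvg_sym_zero :
  (s x / discr (p x) (p x) (s x) - 1 / 2 * Num.sqrt (s x / p x)) / Num.sqrt (s x)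
   @[x --> F] --> (0 : R).
Proof.
have a4 : Num.sqrt (4 * a + 0) = 2 * Num.sqrt a.
  rewrite addr0 sqrtrM// (_ : 4 = 2 ^+ 2) ?sqrtr_sqr ?ger0_norm//.
  by ring.
have sa0 : Num.sqrt a != 0 by rewrite gt_eqF// sqrtr_gt0.
apply: (@cvg_congr _ _ _ (fun x => (Num.sqrt (4 * p x + s x))^-1 - 1 / 2 * (Num.sqrt (p x))^-1) _
  ((Num.sqrt (4 * a + 0))^-1 - 1 / 2 * (Num.sqrt a)^-1)).
- move=> x; rewrite discr_sym sqrtrM ?ltW// sqrtrV ?ltW//.
  have s1 : Num.sqrt (s x) != 0 by rewrite gt_eqF// sqrtr_gt0.
  have s2 : Num.sqrt (p x) != 0 by rewrite gt_eqF// sqrtr_gt0.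
  have s3 : Num.sqrt (4 * p x + s x) != 0.
    by rewrite gt_eqF// sqrtr_gt0 addr_gt0// mulr_gt0.
  rewrite -[X in X / (_ * _)](sqr_sqrtr (ltW (s0 x))); field.
  by rewrite s1 s2 s3.
- by rewrite a4; field.
apply: cvgB.
  apply: cvgV; first by rewrite a4 mulf_neq0.
  apply: continuous_cvg; first exact: sqrt_continuous.
  by apply: cvgD => //; apply: cvgM => //; exact: cvg_cst.
apply: cvgM; first exact: cvg_cst.
apply: cvgV => //; apply: continuous_cvg => //; exact: sqrt_continuous.
Qed.

(** By symmetry each side receives half of what the state 0 leaves. *)
Lemma cvg_sym_side :
  ((discr (p x) (p x) (s x) - s x) / (2 * discr (p x) (p x) (s x))
     - (1 / 2 - 1 / 4 * Num.sqrt (s x / p x))) / Num.sqrt (s x)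
   @[x --> F] --> (0 : R).
Proof.
apply: (@cvg_congr _ _ _ (fun x => - (1 / 2) *
   ((s x / discr (p x) (p x) (s x) - 1 / 2 * Num.sqrt (s x / p x)) / Num.sqrt (s x))) _
   (- (1 / 2) * 0)).
- move=> x.
  have n1 : Num.sqrt (s x) != 0 by rewrite gt_eqF// sqrtr_gt0.
  have n2 : discr (p x) (p x) (s x) != 0 by rewrite gt_eqF// discr_gt0.
  by field; rewrite n1 n2.
- by rewrite mulr0.
by apply: cvgM; [exact: cvg_cst|exact: cvg_sym_zero].
Qed.

End symmetric_limits.

(** * Asymptotic expressions *)

Section asymptotics.
Variable R : realType.

Lemma line_green_opp (p q s : R) (m : nat) :
  line_green p q s (- m%:Z) = ratio q p s ^+ m / discr p q s.
Proof. by case: m => [|m]; rewrite ?oppr0 -?NegzE /= ?expr0. Qed.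

Let split_parameters (I : Type) (p q r s : I -> R) :
  (forall x, [/\ 0 < p x, 0 < q x, 0 <= r x, 0 < s x & p x + q x + r x + s x = 1]) ->
  [/\ forall x, 0 < p x, forall x, 0 < q x, forall x, 0 <= r x, forall x, 0 < s x
    & forall x, p x + q x + r x + s x = 1].
Proof. by move=> par; split => x; case: (par x). Qed.

Lemma asymptotic_drift_nonneg (n : int) : 0 <= n ->
  asymptotic_expression (fun p q : R => q < p) (fun s => s ^+ 2) [set n] (drift_nonneg n).
Proof.
case: n => // m _ I F FF p q r s a b d T P X par qp a0 b0 ba pa qb sc hX.
have [px qx rx sx sum] := split_parameters par.
apply: (cvg_congr _ erefl (cvg_drift_point px qx sx qp b0 ba pa qb sc m)) => x /=.
by rewrite (absorbed_in_line (px x) (qx x) (rx x) (sx x) (sum x) (hX x)).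
Qed.

Lemma asymptotic_drift_nonpos (n : int) : n <= 0 ->
  asymptotic_expression (fun p q : R => q < p) (fun s => s ^+ 2) [set n] (drift_nonpos n).
Proof.
move=> n0; have [m ->] : exists m : nat, n = - m%:Z by exists `|n|%N; lia.
move=> I F FF p q r s a b d T P X par qp a0 b0 ba pa qb sc hX.
have [px qx rx sx sum] := split_parameters par.
apply: (cvg_congr _ erefl (cvg_drift_point_left px qx sx qp a0 b0 ba pa qb sc m)) => x /=.
rewrite (absorbed_in_line (px x) (qx x) (rx x) (sx x) (sum x) (hX x)).
by rewrite line_green_opp /drift_nonpos opprK -exprz_inv invf_div.
Qed.

Lemma asymptotic_drift_left :
  asymptotic_expression (fun p q : R => q < p) (fun s => s ^+ 2)
    [set n : int | n <= -1] (@drift_left R).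
Proof.
move=> I F FF p q r s a b d T P X par qp a0 b0 ba pa qb sc hX.
have [px qx rx sx sum] := split_parameters par.
apply: (cvg_congr _ erefl (cvg_drift_left px qx sx qp ba pa qb sc)) => x /=.
by rewrite (absorbed_in_left (px x) (qx x) (rx x) (sx x) (sum x) (hX x)).
Qed.

Lemma asymptotic_drift_right :
  asymptotic_expression (fun p q : R => q < p) (fun s => s)
    [set n : int | 1 <= n] (@drift_right R).
Proof.
move=> I F FF p q r s a b d T P X par qp a0 b0 ba pa qb sc hX.
have [px qx rx sx sum] := split_parameters par.
apply: (cvg_congr _ erefl (cvg_drift_right px qx sx qp ba pa qb sc)) => x /=.
by rewrite (absorbed_in_right (px x) (qx x) (rx x) (sx x) (sum x) (hX x)).
Qed.

Lemma asymptotic_sym_right :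
  asymptotic_expression (fun p q : R => p = q) (fun s => Num.sqrt s)
    [set n : int | 1 <= n] (@sym_side R).
Proof.
move=> I F FF p q r s a b d T P X par pq a0 b0 ab pa qb sc hX.
have [px qx rx sx sum] := split_parameters par.
apply: (cvg_congr _ erefl (cvg_sym_side px sx a0 pa sc)) => x /=.
rewrite (absorbed_in_right (px x) (qx x) (rx x) (sx x) (sum x) (hX x)) /=.
by rewrite -(pq x) subrr addr0.
Qed.

Lemma asymptotic_sym_left :
  asymptotic_expression (fun p q : R => p = q) (fun s => Num.sqrt s)
    [set n : int | n <= -1] (@sym_side R).
Proof.
move=> I F FF p q r s a b d T P X par pq a0 b0 ab pa qb sc hX.
have [px qx rx sx sum] := split_parameters par.
apply: (cvg_congr _ erefl (cvg_sym_side px sx a0 pa sc)) => x /=.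
rewrite (absorbed_in_left (px x) (qx x) (rx x) (sx x) (sum x) (hX x)) /=.
by rewrite -(pq x) subrr subr0.
Qed.

Lemma asymptotic_sym_zero :
  asymptotic_expression (fun p q : R => p = q) (fun s => Num.sqrt s)
    [set 0 : int] (@sym_zero R).
Proof.
move=> I F FF p q r s a b d T P X par pq a0 b0 ab pa qb sc hX.
have [px qx rx sx sum] := split_parameters par.
apply: (cvg_congr _ erefl (cvg_sym_zero px sx a0 pa sc)) => x /=.
rewrite (absorbed_in_line (px x) (qx x) (rx x) (sx x) (sum x) (hX x)) /=.
by rewrite -(pq x) expr0 [1 / discr _ _ _]mul1r.
Qed.

End asymptotics.

(** * The conjugation theorem *)

Theorem theorem16 (R : realType) (p q r s : R)
    (hp : 0 < p) (hq : 0 < q) (hr : 0 <= r) (hs : 0 < s)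
    (hsum : p + q + r + s = 1)
    (Pr Qr Sr : R)
    (hPr : Pr = p / (1 - r)) (hQr : Qr = q / (1 - r)) (hSr : Sr = s / (1 - r))
    (D : domain) (hD : valid_domain D) (i : int) (hi : in_domain D i)
    (d : measure_display) (T : measurableType d) (P : probability T R)
    (X : nat -> T -> status) (hX : is_walk p q r s D i P X)
    (d' : measure_display) (T' : measurableType d') (P' : probability T' R)
    (X' : nat -> T' -> status) (hX' : is_walk Pr Qr 0 Sr D i P' X') :
  Pr + Qr + Sr = 1
  /\
  (* (1) minimum and maximum *)
  (forall A : set (\bar R), measurable A ->
     pushforward P (fun w => walk_min R (X^~ w)) A =
     pushforward P' (fun w => walk_min R (X'^~ w)) A
     /\
     pushforward P (fun w => walk_max R (X^~ w)) A =
     pushforward P' (fun w => walk_max R (X'^~ w)) A)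
  /\
  (* (2) absorption probabilities *)
  (forall n : int, in_domain D n ->
     P (absorbed_in X [set n]) = P' (absorbed_in X' [set n]))
  /\
  (* (3) asymptotic expressions for absorption on the whole line from 0 *)
  ((forall n : int, 0 <= n ->
      asymptotic_expression (fun p q => q < p) (fun s => s ^+ 2)
        [set n] (@drift_nonneg R n)
      /\ (q < p -> drift_nonneg n Pr Qr Sr = drift_nonneg n p q s))
   /\
   (forall n : int, n <= 0 ->
      asymptotic_expression (fun p q => q < p) (fun s => s ^+ 2)
        [set n] (@drift_nonpos R n)
      /\ (q < p -> drift_nonpos n Pr Qr Sr = drift_nonpos n p q s))
   /\
   (asymptotic_expression (fun p q => q < p) (fun s => s ^+ 2)
      [set n : int | n <= -1] (@drift_left R)
    /\ (q < p -> drift_left Pr Qr Sr = drift_left p q s))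
   /\
   (asymptotic_expression (fun p q => q < p) (fun s => s)
      [set n : int | 1 <= n] (@drift_right R)
    /\ (q < p -> drift_right Pr Qr Sr = drift_right p q s))
   /\
   (asymptotic_expression (fun p q => p = q) (fun s => Num.sqrt s)
      [set n : int | 1 <= n] (@sym_side R)
    /\ asymptotic_expression (fun p q => p = q) (fun s => Num.sqrt s)
         [set n : int | n <= -1] (@sym_side R)
    /\ (p = q -> sym_side Pr Qr Sr = sym_side p q s))
   /\
   (asymptotic_expression (fun p q => p = q) (fun s => Num.sqrt s)
      [set 0 : int] (@sym_zero R)
    /\ (p = q -> sym_zero Pr Qr Sr = sym_zero p q s)))
  /\
  (* (4) value of the game *)
  ('E_P[fun w => (final_position (X^~ w))%:~R] =
   'E_P'[fun w => (final_position (X'^~ w))%:~R])%E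
  /\
  (* expected time until absorption *)
  (\int[P']_w absorption_time R (X'^~ w) =
   (1 - r)%:E * \int[P]_w absorption_time R (X^~ w))%E.
Proof.
have params : walk_parameters p q r s by split => //; exact: ltW.
have r1 : 0 < 1 - r by lra.
have rn : 1 - r != 0 by rewrite gt_eqF.
have qn : q != 0 by rewrite gt_eqF.
have pn : p != 0 by rewrite gt_eqF.
subst Pr Qr Sr.
have drift0 : q < p -> p - q != 0 by move=> qp; rewrite gt_eqF// subr_gt0.
have drift1 : q < p -> p / (1 - r) - q / (1 - r) != 0.
  by move=> /drift0 pq; rewrite -mulrBl mulf_neq0// invr_neq0.
have sqrtE : s / (1 - r) / (p / (1 - r)) = s / p by field; rewrite pn rn.
have ratioE : p / (1 - r) / (q / (1 - r)) = p / q by field; rewrite qn rn.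
split; first by rewrite -!mulrDl (_ : p + q + s = 1 - r) ?divff//; lra.
split.
  move=> A mA; split; first exact: (walk_min_law params hX hX').
  exact: (walk_max_law params hX hX').
split; first by move=> n _; rewrite (absorbed_in_conjugate params hX hX').
split; last first.
  split; first exact: (expected_final_position_conjugate params hX hX').
  exact: (expected_absorption_time_conjugate params hX hX').
split.
  move=> n n0; split; first exact: asymptotic_drift_nonneg.
  by move=> qp; rewrite /drift_nonneg; field; rewrite rn drift0.
split.
  move=> n n0; split; first exact: asymptotic_drift_nonpos.
  by move=> qp; rewrite /drift_nonpos ratioE; field; rewrite rn drift0.
split.
  split; first exact: asymptotic_drift_left.
  by move=> qp; rewrite /drift_left; field; rewrite rn drift0.
split.
  split; first exact: asymptotic_drift_right.
  by move=> qp; rewrite /drift_right; field; rewrite rn drift0.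
split.
  split; first exact: asymptotic_sym_right.
  split; first exact: asymptotic_sym_left.
  by move=> _; rewrite /sym_side sqrtE.
split; first exact: asymptotic_sym_zero.
by move=> _; rewrite /sym_zero sqrtE.
Qed.
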